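(* Let $N\ge 1$, let $t_0>0$, and let $G\in\mathbb{R}^{N\times N}$ be arbitrary. Consider the ODE $$\ddot x(t)+\frac{3}{t}\dot x(t)+Gx(t)=0,\qquad t\in[t_0,\infty),\quad x(t)\in\mathbb{R}^N. \qquad (\ast)$$ (a) If $G$ has an eigenvalue $\lambda\in\mathbb{C}$ with $\lambda\notin\mathbb{R}_{\ge 0}$, then for Lebesgue-almost every initial condition $(x(t_0),\dot x(t_0))\in\mathbb{R}^{2N}$ the solution of $(\ast)$ grows exponentially. In particular, there exist initial conditions with exponential growth. (b) Suppose all eigenvalues $\lambda_1,\dots,\lambda_N$ of $G$ are in $\mathbb{R}_{\ge 0}$ and $G$ is diagonalizable, and let $P$ be an invertible matrix such that $P^{-1}GP$ is diagonal. Then every solution of $(\ast)$ is bounded and converges: there is $x^\infty\in\mathcal{N}(G)$ with $x(t)\to x^\infty$ and $\dot x(t)\to 0$ as $t\to\infty$. Moreover, $$\sup_{t\ge t_0}\|x(t)\|_2\le \kappa(P)\bigl(\|x(t_0)\|_2+C\,\|\dot x(t_0)\|_2\bigr),$$ where $C=\max\{t_0/2,\ \lambda_{\min}^{-1/2}\}$ with $\lambda_{\min}=\min\{\lambda_i:\lambda_i>0\}$, and $C=t_0/2$ if all eigenvalues are zero.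
   Context: $\mathbb{R}_{\ge 0}$ denotes the nonnegative reals, regarded as a subset of $\mathbb{C}$. $\mathcal{N}(G)=\{x: Gx=0\}$. $\kappa(P)=\|P\|_2\|P^{-1}\|_2$ is the spectral condition number. ''The solution grows exponentially'' means $\|x(t)\|_2\to\infty$ exponentially, i.e. there are constants $c,\alpha>0$ (depending on the initial condition) with $\|x(t)\|_2\ge c\,e^{\alpha t}$ for all sufficiently large $t$. *)

(* Defs.v *)
From HB Require Import structures.
From mathcomp Require Import all_boot all_order all_algebra.
From mathcomp Require Import all_classical all_reals all_analysis.
From mathcomp Require Import complex.

Set Implicit Arguments.
Unset Strict Implicit.
Unset Printing Implicit Defensive.

Import Order.TTheory GRing.Theory Num.Theory.
Import numFieldNormedType.Exports.

Local Open Scope classical_set_scope.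
Local Open Scope ring_scope.
Local Open Scope complex_scope.

Definition complexify (R : realType) m n (A : 'M[R]_(m, n)) : 'M[R[i]]_(m, n) :=
  map_mx (real_complex R) A.

Definition l2norm (R : realType) n (x : 'cV[R]_n) : R :=
  Num.sqrt (\sum_i x i 0 ^+ 2).

Definition l2normC (R : realType) n (z : 'cV[R[i]]_n) : R :=
  Num.sqrt (\sum_i (complex.Re (z i 0) ^+ 2 + complex.Im (z i 0) ^+ 2)).

Definition specnorm (R : realType) n (P : 'M[R[i]]_n) : R :=
  sup [set l2normC (P *m z) | z in [set z : 'cV[R[i]]_n | l2normC z <= 1]].

Definition cond_number (R : realType) n (P : 'M[R[i]]_n) : R :=
  specnorm P * specnorm (invmx P).

(* Derivative of [f] at [t] relative to [D]: one-sided at an endpoint of an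
   interval [D], two-sided at interior points. *)
Definition has_deriv_on (R : realType) n (D : set R) (f : R -> 'cV[R]_n)
    (t : R) (l : 'cV[R]_n) : Prop :=
  (fun s => (s - t)^-1 *: (f s - f t)) @ within D t^' --> l.

(* [x] solves x'' + (3/t) x' + G x = 0 on [t0, +oo[ and [v] is its velocity x';
   the values of [x] and [v] to the left of [t0] are irrelevant. *)
Definition ode_solution (R : realType) n (t0 : R) (G : 'M[R]_n)
    (x v : R -> 'cV[R]_n) : Prop :=
  forall t, t0 <= t ->
    has_deriv_on [set s | t0 <= s] x t (v t) /\
    exists a : 'cV[R]_n, has_deriv_on [set s | t0 <= s] v t a /\
      a + (3 / t) *: v t + G *m x t = 0.

Definition grows_exponentially (R : realType) n (x : R -> 'cV[R]_n) : Prop :=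
  exists c alpha : R, [/\ 0 < c, 0 < alpha &
    \forall t \near +oo, c * expR (alpha * t) <= l2norm (x t)].

(* The initial condition (x(t0), x'(t0)) is encoded as the stacked vector [z]. *)
Definition ivp_solution (R : realType) n (t0 : R) (G : 'M[R]_n)
    (z : 'cV[R]_(n + n)) (x v : R -> 'cV[R]_n) : Prop :=
  [/\ ode_solution t0 G x v, x t0 = usubmx z & v t0 = dsubmx z].

(* Null sets of the n-dimensional Lebesgue measure: sets covered by countably
   many closed boxes of arbitrarily small total volume. *)
Definition lebesgue_null (R : realType) n (A : set 'cV[R]_n) : Prop :=
  forall e : R, 0 < e -> exists a b : nat -> 'cV[R]_n,
    [/\ forall k i, a k i 0 <= b k i 0,
        A `<=` \bigcup_k [set x | forall i, a k i 0 <= x i 0 <= b k i 0] &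
        (\sum_(0 <= k <oo) (\prod_i (b k i 0 - a k i 0))%:E <= e%:E)%E].

Definition lebesgue_ae (R : realType) n (Q : 'cV[R]_n -> Prop) : Prop :=
  lebesgue_null [set z | ~ Q z].

Definition pos_eigenvalues (R : realType) n (G : 'M[R]_n) : set R :=
  [set r | 0 < r /\ eigenvalue (complexify G) r%:C].

(* [pos_eigenvalues G] is finite, so that its [inf], when it is nonempty, is its
   least element. *)
Definition velocity_const (R : realType) n (t0 : R) (G : 'M[R]_n) : R :=
  if `[< pos_eigenvalues G !=set0 >]
  then Num.max (t0 / 2) (Num.sqrt (inf (pos_eigenvalues G)))^-1
  else t0 / 2.

(* Main.v *)
Require Import Defs.
From HB Require Import structures.
From mathcomp Require Import all_boot all_order all_algebra.
From mathcomp Require Import all_classical all_reals all_analysis.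
From mathcomp Require Import complex ring lra.

Set Implicit Arguments.
Unset Strict Implicit.
Unset Printing Implicit Defensive.

Import Order.TTheory GRing.Theory Num.Theory.
Import numFieldNormedType.Exports.

Local Open Scope classical_set_scope.
Local Open Scope ring_scope.
Local Open Scope complex_scope.
Import ComplexField.Normc.

(** Exponential growth. A left eigenvector [w] of [G] for [lambda] reduces the
    system to the scalar complex equation [y'' + (3/t) y' + lambda y = 0] for
    [y = w x].  As [lambda] is not in [0, +oo[, [- lambda = mu^2] with
    [a = Re mu > 0].  With [p = y' + mu y] and [q = y' - mu y], the quantities
    [|p|^2 - |q|^2] and [|p|^2 - 4 |q|^2] eventually increase; if the former is
    ever positive, the latter becomes positive and grows like [exp (a t)], and so
    does [|y|^2].  Otherwise [|p| <= |q|] and [y, y'] are [O(t^-2)].  For two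
    solutions of the latter kind the Wronskian, which is a multiple of [t^-3], must
    vanish, so their initial data [(y(t0), y'(t0))] are proportional.  Hence the
    initial data without exponential growth lie in a real hyperplane, which is
    null by an explicit box covering.

    Existence. In the variable [u = 1 - t0^2/t^2], which maps [[t0, +oo[] to
    [[0, 1[], the equation becomes [(1 - u)^3 x_uu = - (t0^2/4) G x]; its power
    series solutions at [u = 0] converge for [|u| < 1].

    Boundedness. In the coordinates [P^-1 x] the system decouples into scalar
    equations with [lambda_i >= 0]: the energy [lambda_i y^2 + y'^2] is
    nonincreasing and tends to [0] if [lambda_i > 0], and the solution is explicit
    if [lambda_i = 0]. *)

(** * Real functions on a half-line *)

Lemma is_derive_slope (R : realType) (F : R -> R) (t l : R) :
  (s - t)^-1 * (F s - F t) @[s --> t^'] --> l -> is_derive t 1 F l.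
Proof.
move=> Fl.
suff H : h^-1 *: ((F \o shift t) (h *: 1) - F t) @[h --> 0^'] --> l.
  by split; [apply/cvg_ex; exists l | exact: cvg_lim H].
move/cvgrPdist_lt : Fl => Fl; apply/cvgrPdist_lt => e /Fl.
move=> /nbhs_ballP[d /= d0 H]; apply/nbhs_ballP; exists d => //= h.
rewrite /ball/= sub0r normrN => hd h0.
have := H (h + t); rewrite /ball/= opprD addrCA subrr addr0 normrN.
move=> /(_ hd); rewrite -subr_eq0 !addrK => /(_ h0).
by rewrite /GRing.scale/= mulr1.
Qed.

(* Extending linearly to the left of [t0] turns the one-sided derivative at [t0]
   into a two-sided one, so that the calculus of [is_derive] applies on the
   closed half-line. *)
Lemma slope_extension (R : realType) (t0 : R) (f df : R -> R) :
  (forall t : R, t0 <= t ->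
    (s - t)^-1 * (f s - f t) @[s --> within [set s | t0 <= s] t^'] --> df t) ->
  exists2 F : R -> R, (forall t : R, t0 <= t -> F t = f t) &
    forall t, t0 <= t -> is_derive t 1 F (df t).
Proof.
move=> H.
exists (fun s => if t0 <= s then f s else f t0 + df t0 * (s - t0)) => [t -> //|].
move=> t t0t; apply: is_derive_slope.
apply/cvgrPdist_lt => e e0.
move/cvgrPdist_lt: (H t t0t) => /(_ _ e0)/nbhs_ballP[d /= d0 Hd].
apply/nbhs_ballP.
(* For [t] above [t0] the radius [t - t0] keeps the ball inside the half-line, where the extension
   is [f]. *)
exists (if t0 == t then d else Num.min d (t - t0)).
  case: ifPn => //= t0t'; rewrite lt_min d0 subr_gt0.
  by rewrite lt_neqAle t0t'.
move=> s /= st sNt; rewrite t0t; case: ifPn => t0s.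
  apply: Hd => //=; apply: (lt_le_trans st).
  by case: ifP => // _; rewrite ge_min lexx.
move: st; case: ifPn => [/eqP <- _|t0t'].
  have st0 : s - t0 != 0 by rewrite subr_eq0; apply: contraNneq t0s => ->.
  by rewrite [f t0 + _]addrC addrK mulrCA mulVf// mulr1 subrr normr0.
rewrite /ball/= => /lt_le_trans; move=> /(_ (t - t0)); rewrite ge_min lexx orbT.
move=> /(_ isT) /(le_lt_trans (ler_norm _)).
by rewrite ltrD2l ltrN2 => /ltW; rewrite (negbTE t0s).
Qed.

Lemma derive_le0_nonincr (R : realType) (T : R) (F dF : R -> R) :
  (forall t : R, T <= t -> is_derive t 1 F (dF t)) ->
  (forall t : R, T <= t -> dF t <= 0) ->
  forall s t : R, T <= s -> s <= t -> F t <= F s.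
Proof.
move=> FdF dF0 s t Ts st.
have cF : {within `[s, t], continuous F}.
  apply: derivable_within_continuous => r.
  rewrite in_itv/= => /andP[sr _].
  by have [] := FdF r (le_trans Ts sr).
have FdF' r : r \in `]s, t[ -> is_derive r 1 F (dF r).
  rewrite in_itv/= => /andP[sr _]; apply: FdF; exact: le_trans Ts (ltW sr).
have [c] := MVT_segment st FdF' cF.
rewrite in_itv/= => /andP[sc _] e; rewrite -subr_le0 e mulr_le0_ge0//.
  exact/dF0/(le_trans Ts).
by rewrite subr_ge0.
Qed.

Lemma derive_ge0_nondecr (R : realType) (T : R) (F dF : R -> R) :
  (forall t : R, T <= t -> is_derive t 1 F (dF t)) ->
  (forall t : R, T <= t -> 0 <= dF t) ->
  forall s t : R, T <= s -> s <= t -> F s <= F t.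
Proof.
move=> FdF dF0 s t Ts st; rewrite -lerN2.
apply: (@derive_le0_nonincr _ T (- F) (- dF)) => // r Tr.
  exact/is_deriveN/FdF.
by rewrite oppr_le0 dF0.
Qed.

(** * Exponential growth *)

(* [y1 + i y2] solves [y'' + (3/t) y' - (a + i b)^2 y = 0] and [v1 + i v2] is its
   derivative. *)
Definition damped_osc (R : realType) (t0 a b : R) (y1 y2 v1 v2 : R -> R) :=
  forall t : R, t0 <= t ->
  [/\ is_derive t 1 y1 (v1 t), is_derive t 1 y2 (v2 t),
      is_derive t 1 v1
        (- (3 / t) * v1 t + (a ^+ 2 - b ^+ 2) * y1 t - 2 * a * b * y2 t) &
      is_derive t 1 v2
        (- (3 / t) * v2 t + (a ^+ 2 - b ^+ 2) * y2 t + 2 * a * b * y1 t)].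

(** The bracket is quadratic in the solution, so the weight [t ^+ 4] means that [y] and [y'] are
    [O(t^-2)]. A Wronskian of two such solutions is then [O(t^-4)], below the exact rate [t^-3]. *)
Definition decays_quadratically (R : realType) (y1 y2 v1 v2 : R -> R) :=
  exists C : R, exists T0 : R, forall t : R, T0 <= t ->
     t ^+ 4 * (v1 t ^+ 2 + v2 t ^+ 2 + y1 t ^+ 2 + y2 t ^+ 2) <= C.

Section damped_osc_growth.
Variables (R : realType) (t0 a b : R).
Hypotheses (t0_gt0 : 0 < t0) (a_gt0 : 0 < a).

Section growth_or_decay.
Variables (y1 y2 v1 v2 : R -> R).
Hypothesis sol : damped_osc t0 a b y1 y2 v1 v2.

(** Real and imaginary parts of [p = y' + mu y] and [q = y' - mu y], where [mu = a + i b]; [P] and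
    [Q] are the squared moduli. *)
Let p1 t := v1 t + (a * y1 t - b * y2 t).
Let p2 t := v2 t + (a * y2 t + b * y1 t).
Let q1 t := v1 t - (a * y1 t - b * y2 t).
Let q2 t := v2 t - (a * y2 t + b * y1 t).
Let P t := p1 t ^+ 2 + p2 t ^+ 2.
Let Q t := q1 t ^+ 2 + q2 t ^+ 2.

Let P_ge0 t : 0 <= P t. Proof. by rewrite addr_ge0// sqr_ge0. Qed.
Let Q_ge0 t : 0 <= Q t. Proof. by rewrite addr_ge0// sqr_ge0. Qed.

(** These come from [p' = mu p - (3/t) y'] and [q' = - mu q - (3/t) y'] with [y' = (p + q) / 2]. *)
Let dP t := 2 * a * P t - 3 / t * (P t + (p1 t * q1 t + p2 t * q2 t)).
Let dQ t := - (2 * a * Q t) - 3 / t * (Q t + (p1 t * q1 t + p2 t * q2 t)).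

Let is_derive_P t : t0 <= t -> is_derive t 1 P (dP t).
Proof.
move=> /sol[h1 h2 h3 h4]; rewrite /P /p1 /p2; apply: is_derive_eq.
rewrite /GRing.scale/= /dP /P /p1 /p2 /q1 /q2; ring.
Qed.

Let is_derive_Q t : t0 <= t -> is_derive t 1 Q (dQ t).
Proof.
move=> /sol[h1 h2 h3 h4]; rewrite /Q /q1 /q2; apply: is_derive_eq.
rewrite /GRing.scale/= /dQ /Q /p1 /p2 /q1 /q2; ring.
Qed.

Let dot_le t :
  - (P t + Q t) <= 2 * (p1 t * q1 t + p2 t * q2 t) <= P t + Q t.
Proof.
rewrite /P /Q.
have := sqr_ge0 (p1 t - q1 t); have := sqr_ge0 (p2 t - q2 t).
have := sqr_ge0 (p1 t + q1 t); have := sqr_ge0 (p2 t + q2 t).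
by move=> *; apply/andP; split; lra.
Qed.

(** From [8 / a] on, [8 / t <= a], so the friction terms are absorbed by half of the rates
    [2 * a]. *)
Let T := Num.max t0 (8 / a).
Let t0T : t0 <= T. Proof. by rewrite le_max lexx. Qed.
Let T_gt0 : 0 < T. Proof. exact: lt_le_trans t0T. Qed.

Let inv_le t : T <= t -> 0 < t^-1 /\ 8 * t^-1 <= a.
Proof.
move=> Tt; have t_gt0 : 0 < t := lt_le_trans T_gt0 Tt.
split; first by rewrite invr_gt0.
rewrite ler_pdivrMr//; move: Tt; rewrite ge_max => /andP[_].
by rewrite ler_pdivrMr// mulrC.
Qed.

(** The cross terms cancel in [P' - Q'], which leaves [2 a (P + Q) - (3/t) (P - Q)]. *)
Let dD1_ge t : T <= t -> a * (P t + Q t) <= dP t - dQ t.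
Proof.
move=> /inv_le[i0 i8]; rewrite /dP /dQ.
have := P_ge0 t; have := Q_ge0 t; move: (_ + p2 t * q2 t) => d.
move: (P t) (Q t) (t^-1) i0 i8 => p q i i0 i8 q0 p0.
have : 0 <= (a - 8 * i) * (p + q).
  by apply: mulr_ge0; rewrite ?subr_ge0// addr_ge0.
have : 0 <= i * p by rewrite mulr_ge0// ltW.
have : 0 <= i * q by rewrite mulr_ge0// ltW.
have : 0 <= a * (p + q) by rewrite mulr_ge0 ?(ltW a_gt0) ?addr_ge0.
lra.
Qed.

(** Here the cross term survives and is controlled by [dot_le]. The weight 4 is what makes [P - 4 Q]
    useful: [|p| > 2 |q|] keeps [p - q = 2 mu y] comparable to [p], which [P > Q] alone does not. *)
Let dD4_ge t : T <= t -> a * (P t + 4 * Q t) <= dP t - 4 * dQ t.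
Proof.
move=> /inv_le[i0 i8]; rewrite /dP /dQ.
have := dot_le t.
move: (p1 t * q1 t + p2 t * q2 t) => d /andP[d1 d2].
have := P_ge0 t; have := Q_ge0 t.
move: (P t) (Q t) (t^-1) i0 i8 d1 d2 => p q i i0 i8 d1 d2 q0 p0.
have : 0 <= (a - 8 * i) * (p + 4 * q).
  by apply: mulr_ge0; rewrite ?subr_ge0// addr_ge0// mulr_ge0.
have : 0 <= i * p by rewrite mulr_ge0// ltW.
have : 0 <= i * q by rewrite mulr_ge0// ltW.
have : 0 <= i * (2 * d + (p + q)) by rewrite mulr_ge0 ?(ltW i0)//; lra.
have : 0 <= a * (p + 4 * q) by rewrite mulr_ge0 ?(ltW a_gt0)// addr_ge0 ?mulr_ge0.
lra.
Qed.

Lemma damped_osc_growth_or_decay :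
  (exists c : R, 0 < c /\ exists T0 : R, forall t : R, T0 <= t ->
     c * expR (a * t) <= y1 t ^+ 2 + y2 t ^+ 2) \/
  decays_quadratically y1 y2 v1 v2.
Proof.
have [[T1 [TT1 D1]]|nD] := pselect (exists T1, T <= T1 /\ 0 < P T1 - Q T1).
  have t0T1 : t0 <= T1 := le_trans t0T TT1.
  (* Once positive, [P - Q] stays at least [d]. *)
  have D1_ge t : T1 <= t -> P T1 - Q T1 <= P t - Q t.
    move=> T1t; apply: (@derive_ge0_nondecr _ T1 (P - Q) (dP - dQ)) => // r T1r.
      have t0r := le_trans t0T1 T1r.
      exact: is_deriveB (is_derive_P t0r) (is_derive_Q t0r).
    apply: le_trans (dD1_ge (le_trans TT1 T1r)).
    by rewrite mulr_ge0 ?(ltW a_gt0)// addr_ge0.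
  set d := P T1 - Q T1 in D1 D1_ge.
  (* Since [(P - 4 Q)' >= a (P + 4 Q) >= a (P - Q) >= a d], the quantity [P - 4 Q] grows at least
     linearly; [T2] below is a time at which this bound has passed 1. *)
  have D4_lin t : T1 <= t ->
      P T1 - 4 * Q T1 - a * d * T1 <= P t - 4 * Q t - a * d * t.
    move=> T1t.
    apply: (@derive_ge0_nondecr _ T1 (fun r => P r - 4 * Q r - a * d * r)
      (fun r => dP r - 4 * dQ r - a * d)) => // r T1r.
      have t0r := le_trans t0T1 T1r.
      have := is_derive_P t0r; have := is_derive_Q t0r => ? ?.
      by apply: is_derive_eq; rewrite /GRing.scale/=; ring.
    rewrite subr_ge0; apply: le_trans (dD4_ge (le_trans TT1 T1r)).
    rewrite ler_pM2l//; apply: le_trans (D1_ge _ T1r) _.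
    by have := Q_ge0 r; lra.
  pose T2 := T1 + (`|P T1 - 4 * Q T1| + 1) / (a * d).
  have ad_gt0 : 0 < a * d by rewrite mulr_gt0.
  have T12 : T1 <= T2 by rewrite lerDl divr_ge0 ?ltW.
  have D4_T2 : 1 <= P T2 - 4 * Q T2.
    have adT2 : a * d * T2 = a * d * T1 + (`|P T1 - 4 * Q T1| + 1).
      by rewrite /T2 mulrDr [X in _ + X]mulrC divfK// gt_eqF.
    have := D4_lin _ T12.
    have := lerNnormlW (lexx `|P T1 - 4 * Q T1|).
    lra.
  (* Integrating factor for [(P - 4 Q)' >= a (P - 4 Q)]. *)
  have D4_exp t : T2 <= t ->
      (P T2 - 4 * Q T2) * expR (- a * T2) <= (P t - 4 * Q t) * expR (- a * t).
    move=> T2t.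
    apply: (@derive_ge0_nondecr _ T2 (fun r => (P r - 4 * Q r) * expR (- a * r))
      (fun r => (dP r - 4 * dQ r - a * (P r - 4 * Q r)) * expR (- a * r)))
      => // r T2r.
      have t0r := le_trans (le_trans t0T1 T12) T2r.
      have := is_derive_P t0r; have := is_derive_Q t0r => ? ?.
      have ? : is_derive r (1 : R) (fun r => expR (- a * r))
          (expR (- a * r) * (- a)).
        apply: (@is_derive1_comp _ expR (fun r => - a * r)).
        by apply: is_derive_eq; rewrite /GRing.scale/=; ring.
      by apply: is_derive_eq; rewrite /GRing.scale/=; ring.
    rewrite mulr_ge0 ?expR_ge0// subr_ge0.
    apply: le_trans (dD4_ge (le_trans (le_trans TT1 T12) T2r)).
    by rewrite ler_pM2l//; have := Q_ge0 r; lra.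
  have m_gt0 : 0 < a ^+ 2 + b ^+ 2 by rewrite ltr_wpDr ?sqr_ge0 ?exprn_gt0.
  (* The 16 comes from [4 |mu|^2 |y|^2 = |p - q|^2 >= (P - 4 Q) / 4], a consequence of
     [|p - 2 q|^2 >= 0]. *)
  left; exists (expR (- a * T2) / (16 * (a ^+ 2 + b ^+ 2))); split.
    by rewrite divr_gt0 ?expR_gt0 ?mulr_gt0.
  exists T2 => t T2t.
  rewrite mulrAC ler_pdivrMr ?mulr_gt0//.
  have H : expR (- a * T2) * expR (a * t) <= P t - 4 * Q t.
    rewrite -(@ler_pM2r _ (expR (- a * t))) ?expR_gt0//.
    rewrite -mulrA -[X in _ * X]expRD (_ : a * t + - a * t = 0); last by ring.
    rewrite expR0 mulr1; apply: le_trans (D4_exp _ T2t).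
    by rewrite ler_peMl ?expR_ge0.
  apply: le_trans H _; have := Q_ge0 t.
  have e : 4 * ((y1 t ^+ 2 + y2 t ^+ 2) * (a ^+ 2 + b ^+ 2)) =
    (p1 t - q1 t) ^+ 2 + (p2 t - q2 t) ^+ 2 by rewrite /p1 /p2 /q1 /q2; ring.
  have : 0 <= P t - 4 * Q t.
    rewrite -(@pmulr_lge0 _ (expR (- a * t))) ?expR_gt0//.
    apply: le_trans (D4_exp _ T2t).
    by rewrite mulr_ge0 ?expR_ge0// (le_trans _ D4_T2).
  move: e; rewrite /P /Q.
  have := sqr_ge0 (p1 t - 2 * q1 t); have := sqr_ge0 (p2 t - 2 * q2 t).
  by move=> *; lra.
right.
have PQ t : T <= t -> P t <= Q t.
  by move=> Tt; rewrite leNgt; apply/negP => QP; apply: nD; exists t; rewrite subr_gt0.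
have m_gt0 : 0 < a ^+ 2 + b ^+ 2 by rewrite ltr_wpDr ?sqr_ge0 ?exprn_gt0.
(* As [P <= Q], the cross term is at least [- Q], so the friction does not increase [Q]. Hence
   [Q' <= - 2 a Q], and [4 / t <= a / 2] pays for the derivative of the weight. *)
have F_le t : T <= t -> t ^+ 4 * Q t <= T ^+ 4 * Q T.
  move=> Tt.
  apply: (@derive_le0_nonincr _ T (fun r => r ^+ 4 * Q r)
    (fun r => r ^+ 4 * dQ r + 4 * r ^+ 3 * Q r)) => // r Tr.
    have := is_derive_Q (le_trans t0T Tr) => ?.
    by apply: is_derive_eq; rewrite /GRing.scale/=; ring.
  have r_gt0 : 0 < r := lt_le_trans T_gt0 Tr.
  have -> : r ^+ 4 * dQ r + 4 * r ^+ 3 * Q r =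
      r ^+ 4 * (dQ r + 4 * r^-1 * Q r) by field; rewrite gt_eqF.
  rewrite mulr_ge0_le0 ?exprn_ge0 ?(ltW r_gt0)// /dQ.
  have [i0 i8] := inv_le Tr.
  have := dot_le r; move: (p1 r * q1 r + p2 r * q2 r) => d /andP[d1 d2].
  have := Q_ge0 r; have := PQ _ Tr.
  move: (P r) (Q r) (r^-1) i0 i8 d1 d2 => p q i i0 i8 d1 d2 pq q0.
  have : 0 <= (a - 8 * i) * q by rewrite mulr_ge0// subr_ge0.
  have : 0 <= i * q by rewrite mulr_ge0// ltW.
  have : 0 <= i * (d + q) by rewrite mulr_ge0 ?(ltW i0)//; lra.
  have : 0 <= a * q by rewrite mulr_ge0 ?(ltW a_gt0).
  lra.
(* Both [|y'|^2 = |p + q|^2 / 4] and [|mu|^2 |y|^2 = |p - q|^2 / 4] are at most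
   [(P + Q) / 2 <= Q]. *)
exists ((1 + (a ^+ 2 + b ^+ 2)^-1) * (T ^+ 4 * Q T)), T => t Tt.
have k_ge0 : 0 <= 1 + (a ^+ 2 + b ^+ 2)^-1 by rewrite addr_ge0 ?invr_ge0 ?ltW.
apply: le_trans (ler_wpM2l k_ge0 (F_le _ Tt)).
rewrite mulrCA; apply: ler_wpM2l.
  by rewrite exprn_ge0// (le_trans (ltW T_gt0)).
have e : 4 * ((y1 t ^+ 2 + y2 t ^+ 2) * (a ^+ 2 + b ^+ 2)) =
  (p1 t - q1 t) ^+ 2 + (p2 t - q2 t) ^+ 2 by rewrite /p1 /p2 /q1 /q2; ring.
have e' : 4 * (v1 t ^+ 2 + v2 t ^+ 2) =
  (p1 t + q1 t) ^+ 2 + (p2 t + q2 t) ^+ 2 by rewrite /p1 /p2 /q1 /q2; ring.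
have := PQ _ Tt; rewrite mulrDl mul1r -addrA => PQt; apply: lerD.
  move: PQt e'; rewrite /P /Q.
  have := sqr_ge0 (p1 t - q1 t); have := sqr_ge0 (p2 t - q2 t).
  by move=> *; lra.
rewrite ler_pdivlMl//.
move: PQt e; rewrite /P /Q.
have := sqr_ge0 (p1 t + q1 t); have := sqr_ge0 (p2 t + q2 t).
by move=> *; lra.
Qed.

End growth_or_decay.
End damped_osc_growth.

(** The complex Wronskian [W = y u - z v] satisfies [W' = - (3/t) W], so [t^3 W] is constant. Decay
    of both solutions gives [W = O(t^-4)], which forces [W = 0]; the two equations are its real and
    imaginary parts at [t0]. *)
Lemma damped_osc_wronskian (R : realType) (t0 a b : R)
    (y1 y2 v1 v2 z1 z2 u1 u2 : R -> R) : 0 < t0 ->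
  damped_osc t0 a b y1 y2 v1 v2 -> damped_osc t0 a b z1 z2 u1 u2 ->
  decays_quadratically y1 y2 v1 v2 -> decays_quadratically z1 z2 u1 u2 ->
  y1 t0 * u1 t0 - y2 t0 * u2 t0 = z1 t0 * v1 t0 - z2 t0 * v2 t0 /\
  y1 t0 * u2 t0 + y2 t0 * u1 t0 = z1 t0 * v2 t0 + z2 t0 * v1 t0.
Proof.
move=> t0_gt0 soly solz [C [T HT]] [C' [T' HT']].
have dbl_le (x s : R) : 2 * x <= s -> - s <= 2 * x -> 2 * `|x| <= s.
  by case: ger0P => *; lra.
suff key (W : R -> R) :
    (forall t : R, t0 <= t -> is_derive t 1 W (- (3 / t) * W t)) ->
    (forall t, 2 * `|W t| <= (v1 t ^+ 2 + v2 t ^+ 2 + y1 t ^+ 2 + y2 t ^+ 2) +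
      (u1 t ^+ 2 + u2 t ^+ 2 + z1 t ^+ 2 + z2 t ^+ 2)) -> W t0 = 0.
  split; apply/eqP; rewrite -subr_eq0; apply/eqP.
    rewrite -[LHS]/((fun t => y1 t * u1 t - y2 t * u2 t -
      (z1 t * v1 t - z2 t * v2 t)) t0).
    apply: key => t.
      move=> t0t; have [? ? ? ?] := soly _ t0t; have [? ? ? ?] := solz _ t0t.
      by apply: is_derive_eq; rewrite /GRing.scale/=; ring.
    rewrite /=; have := sqr_ge0 (y1 t - u1 t); have := sqr_ge0 (y1 t + u1 t).
    have := sqr_ge0 (y2 t - u2 t); have := sqr_ge0 (y2 t + u2 t).
    have := sqr_ge0 (z1 t - v1 t); have := sqr_ge0 (z1 t + v1 t).
    have := sqr_ge0 (z2 t - v2 t); have := sqr_ge0 (z2 t + v2 t).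
    by move=> *; apply: dbl_le; lra.
  rewrite -[LHS]/((fun t => y1 t * u2 t + y2 t * u1 t -
    (z1 t * v2 t + z2 t * v1 t)) t0).
  apply: key => t.
    move=> t0t; have [? ? ? ?] := soly _ t0t; have [? ? ? ?] := solz _ t0t.
    by apply: is_derive_eq; rewrite /GRing.scale/=; ring.
  rewrite /=; have := sqr_ge0 (y1 t - u2 t); have := sqr_ge0 (y1 t + u2 t).
  have := sqr_ge0 (y2 t - u1 t); have := sqr_ge0 (y2 t + u1 t).
  have := sqr_ge0 (z1 t - v2 t); have := sqr_ge0 (z1 t + v2 t).
  have := sqr_ge0 (z2 t - v1 t); have := sqr_ge0 (z2 t + v1 t).
  by move=> *; apply: dbl_le; lra.
move=> dW W_le.
have W_cst t : t0 <= t -> t ^+ 3 * W t = t0 ^+ 3 * W t0.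
  have dF r : t0 <= r -> is_derive r 1 (fun t => t ^+ 3 * W t) 0.
    move=> t0r; have ? := dW _ t0r.
    apply: is_derive_eq; rewrite /GRing.scale/=; field.
    by rewrite gt_eqF// (lt_le_trans t0_gt0).
  move=> t0t; apply/eqP; rewrite eq_le; apply/andP; split.
    exact: (@derive_le0_nonincr _ t0 (fun t => t ^+ 3 * W t) (fun=> 0)).
  exact: (@derive_ge0_nondecr _ t0 (fun t => t ^+ 3 * W t) (fun=> 0)).
apply/eqP/negP => /negP W0.
have w_gt0 : 0 < `|t0 ^+ 3 * W t0|.
  by rewrite normr_gt0 mulf_neq0// expf_neq0// gt_eqF.
(* A time beyond all thresholds at which [t^4 |W t| = t |t0^3 W t0|] exceeds [|C| + |C'|]. *)
pose t := `|t0| + `|T| + `|T'| + (`|C| + `|C'|) / `|t0 ^+ 3 * W t0|.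
have K_ge0 : 0 <= (`|C| + `|C'|) / `|t0 ^+ 3 * W t0|.
  by rewrite divr_ge0// addr_ge0.
have t0t : t0 <= t.
  by apply: le_trans (ler_norm _) _; rewrite /t -!addrA lerDl !addr_ge0.
have Tt : T <= t.
  apply: le_trans (ler_norm _) _; rewrite /t [`|t0| + _]addrC -!addrA lerDl.
  by rewrite !addr_ge0.
have T't : T' <= t.
  apply: le_trans (ler_norm _) _; rewrite /t [_ + `|T'|]addrC -!addrA lerDl.
  by rewrite !addr_ge0.
have t_gt0 : 0 < t := lt_le_trans t0_gt0 t0t.
have : (`|C| + `|C'|) < t * `|t0 ^+ 3 * W t0|.
  rewrite -ltr_pdivrMr// /t ltrDr -addrA ltr_pwDl ?addr_ge0//.
  by rewrite normr_gt0 gt_eqF.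
rewrite -(W_cst _ t0t) normrM ger0_norm ?exprn_ge0 ?ltW// mulrA -exprS.
have := HT _ Tt; have := HT' _ T't.
have := ler_wpM2l (exprn_ge0 4 (ltW t_gt0)) (W_le t).
have := ler_norm C; have := ler_norm C'.
have := mulr_ge0 (exprn_ge0 4 (ltW t_gt0)) (normr_ge0 (W t)).
move: (t ^+ 4) (`|W t|) (`|C|) (`|C'|) => *; nra.
Qed.

(** * Linear functionals of solutions *)

Lemma cvg_mx_functional (R : realType) n (q : 'rV[R]_n) (T : Type)
    (F : set_system T) (FF : Filter F) (f : T -> 'cV[R]_n) (l : 'cV[R]_n) :
  f @ F --> l -> (q *m f s) 0 0 @[s --> F] --> (q *m l) 0 0.
Proof.
move=> fl; under eq_cvg do rewrite mxE; rewrite mxE.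
apply: (@cvg_big _ _ +%R) => [|i _]; first exact: add_continuous.
apply: cvgMl_tmp; exact: cvg_comp fl (@coord_continuous _ _ _ i 0 l).
Qed.

Lemma cvg_cV (R : realType) n (T : Type)
    (F : set_system T) (FF : Filter F) (f : T -> 'cV[R]_n) (l : 'cV[R]_n) :
  (forall i, f s i 0 @[s --> F] --> l i 0) -> f @ F --> l.
Proof.
move=> fl; apply/cvg_ballP => e e0.
have H : \forall s \near F, forall i, ball (l i 0) e (f s i 0).
  apply: filter_forall => i; have /cvg_ballP := fl i; exact.
near=> s; split=> // i j; rewrite ord1.
by move: i; near: s.
Unshelve. all: by end_near. Qed.

(** [Y] and [V] are the extensions of the projected solution to the left of [t0]: they agree with it
    only on the half-line, but have two-sided derivatives there. *)
Lemma ode_solution_functional (R : realType) n (t0 : R) (G : 'M[R]_n) x v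
    (q : 'rV[R]_n) : ode_solution t0 G x v ->
  exists Y V : R -> R,
   [/\ forall t, t0 <= t -> Y t = (q *m x t) 0 0,
       forall t, t0 <= t -> V t = (q *m v t) 0 0,
       forall t, t0 <= t -> is_derive t 1 Y (V t) &
       forall t, t0 <= t ->
         is_derive t 1 V (- (3 / t) * V t - (q *m G *m x t) 0 0)].
Proof.
move=> sol.
have slope (f : R -> 'cV[R]_n) t (l : 'cV[R]_n) :
    has_deriv_on [set s | t0 <= s] f t l ->
    (s - t)^-1 * ((q *m f s) 0 0 - (q *m f t) 0 0)
      @[s --> within [set s | t0 <= s] t^'] --> (q *m l) 0 0.
  move=> /(@cvg_mx_functional _ _ q _ _ _); apply: cvg_trans; apply: near_eq_cvg.
  by near=> s; rewrite -scalemxAr mulmxBr !mxE.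
have [Y Ye dY] := @slope_extension R t0 (fun t => (q *m x t) 0 0)
  (fun t => (q *m v t) 0 0) (fun t t0t => slope _ _ _ (sol t t0t).1).
have [t t0t|V Ve dV] := @slope_extension R t0 (fun t => (q *m v t) 0 0)
  (fun t => (q *m (- ((3 / t) *: v t) - G *m x t)) 0 0).
  have [_ [a [ha ea]]] := sol t t0t; apply: slope.
  suff -> : - (3 / t *: v t) - G *m x t = a by [].
  by apply/eqP; rewrite -subr_eq0 -oppr_eq0 -ea !opprD !opprK addrC addrA.
exists Y, V; split => // t t0t; first by rewrite Ve//; exact: dY.
rewrite Ve//; have := dV t t0t; congr (is_derive _ _ _ _).
by rewrite mulmxBr mulmxN -scalemxAr -mulmxA !mxE mulNr.
Unshelve. all: by end_near. Qed.

Lemma norm_functional_le (R : realType) n (q : 'rV[R]_n) (x : 'cV[R]_n) :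
  `|(q *m x) 0 0| <= (\sum_j `|q 0 j|) * l2norm x.
Proof.
rewrite mxE mulr_suml (le_trans (ler_norm_sum _ _ _))//; apply: ler_sum => j _.
rewrite normrM ler_wpM2l// /l2norm -(@sqrtr_sqr _ (x j 0)) ler_sqrt.
  by rewrite (bigD1 j)//= lerDl sumr_ge0// => i _; exact: sqr_ge0.
by rewrite sumr_ge0// => i _; exact: sqr_ge0.
Qed.

(** * Real and imaginary parts, and the square root of [- lambda] *)

Lemma Re_sum (R : realType) (I : finType) (F : I -> R[i]) :
  complex.Re (\sum_i F i) = \sum_i complex.Re (F i).
Proof. by apply: (big_morph (@complex.Re R)) => // -[? ?] [? ?]. Qed.

Lemma Im_sum (R : realType) (I : finType) (F : I -> R[i]) :
  complex.Im (\sum_i F i) = \sum_i complex.Im (F i).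
Proof. by apply: (big_morph (@complex.Im R)) => // -[? ?] [? ?]. Qed.

Lemma Re_mulmx_complexify (R : realType) p m n (w : 'M[R[i]]_(p, m))
    (G : 'M[R]_(m, n)) :
  map_mx (@complex.Re R) (w *m complexify G) = map_mx (@complex.Re R) w *m G.
Proof.
apply/matrixP => i j; rewrite !mxE.
rewrite Re_sum; apply: eq_bigr => k _; rewrite !mxE.
by case: (w i k) => c d /=; rewrite mulr0 subr0.
Qed.

Lemma Im_mulmx_complexify (R : realType) p m n (w : 'M[R[i]]_(p, m))
    (G : 'M[R]_(m, n)) :
  map_mx (@complex.Im R) (w *m complexify G) = map_mx (@complex.Im R) w *m G.
Proof.
apply/matrixP => i j; rewrite !mxE.
rewrite Im_sum; apply: eq_bigr => k _; rewrite !mxE.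
by case: (w i k) => c d /=; rewrite mulr0 add0r.
Qed.

(** The right-hand side is [- (a + i b)^2]. A square root of [- lambda] with zero real part would
    give [lambda = b^2 >= 0]; otherwise one of the two roots has positive real part. *)
Lemma sqrt_positive_real_part (R : realType) (lambda : R[i]) :
  ~~ (0 <= lambda) -> exists a b : R, 0 < a /\
    lambda = (b ^+ 2 - a ^+ 2) +i* (- (2 * a * b)).
Proof.
move=> lambda_nge0; have := sqr_sqrtc (- lambda).
case: (sqrtc (- lambda)) => a b mu2.
have lambdaE : lambda = (b ^+ 2 - a ^+ 2) +i* (- (2 * a * b)).
  rewrite -[LHS]opprK -mu2 expr2 /=; apply/eqP; rewrite eq_complex /=.
  by apply/andP; split; apply/eqP; ring.
have [a0|a0|a0] := ltrgt0P a; first by exists a, b.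
  exists (- a), (- b); rewrite oppr_gt0 a0 lambdaE; split => //.
  by apply/eqP; rewrite eq_complex /=; apply/andP; split; apply/eqP; ring.
move: lambda_nge0; rewrite lambdaE a0 lecE /=.
by rewrite mulr0 mul0r oppr0 eqxx /= expr0n/= subr0 sqr_ge0.
Qed.

(** * Projection on a left eigenvector, and the hyperplane of non-growing data *)

Section left_eigenvector.
Variables (R : realType) (n : nat) (t0 : R) (G : 'M[R]_n).
Variables (a b : R) (w : 'rV[R[i]]_n).
Hypothesis t0_gt0 : 0 < t0.
Hypothesis a_gt0 : 0 < a.
Hypothesis wG : w *m complexify G = ((b ^+ 2 - a ^+ 2) +i* (- (2 * a * b))) *: w.

Let q1 := map_mx (@complex.Re R) w.
Let q2 := map_mx (@complex.Im R) w.

Let q1G : q1 *m G = (b ^+ 2 - a ^+ 2) *: q1 + (2 * a * b) *: q2.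
Proof.
rewrite -Re_mulmx_complexify wG; apply/rowP => j; rewrite !mxE.
by case: (w 0 j) => c d /=; ring.
Qed.

Let q2G : q2 *m G = (b ^+ 2 - a ^+ 2) *: q2 - (2 * a * b) *: q1.
Proof.
rewrite -Im_mulmx_complexify wG; apply/rowP => j; rewrite !mxE.
by case: (w 0 j) => c d /=; ring.
Qed.

Lemma damped_osc_of_solution (x v : R -> 'cV[R]_n) : ode_solution t0 G x v ->
  exists y1 y2 v1 v2 : R -> R, damped_osc t0 a b y1 y2 v1 v2 /\
    forall t, t0 <= t -> [/\ y1 t = (q1 *m x t) 0 0, y2 t = (q2 *m x t) 0 0,
                             v1 t = (q1 *m v t) 0 0 & v2 t = (q2 *m v t) 0 0].
Proof.
move=> sol.
have [y1 [v1 [ey1 ev1 dy1 dv1]]] := ode_solution_functional q1 sol.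
have [y2 [v2 [ey2 ev2 dy2 dv2]]] := ode_solution_functional q2 sol.
exists y1, y2, v1, v2; split => t t0t; last first.
  by rewrite ey1 ?ey2 ?ev1 ?ev2.
split; [exact: dy1|exact: dy2| |].
  have := dv1 t t0t; congr (is_derive _ _ _ _).
  by rewrite q1G ey1// ey2// mulmxDl -!scalemxAl !mxE; ring.
have := dv2 t t0t; congr (is_derive _ _ _ _).
by rewrite q2G ey1// ey2// mulmxBl -!scalemxAl !mxE; ring.
Qed.

Lemma grows_exponentially_of_functionals (x : R -> 'cV[R]_n) (y1 y2 : R -> R)
    (c T : R) : 0 < c ->
  (forall t, t0 <= t -> y1 t = (q1 *m x t) 0 0 /\ y2 t = (q2 *m x t) 0 0) ->
  (forall t, T <= t -> c * expR (a * t) <= y1 t ^+ 2 + y2 t ^+ 2) ->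
  grows_exponentially x.
Proof.
move=> c_gt0 ey Hc.
pose K := \sum_j `|q1 0 j| + \sum_j `|q2 0 j| + 1.
have S1 : 0 <= \sum_j `|q1 0 j| by rewrite sumr_ge0.
have S2 : 0 <= \sum_j `|q2 0 j| by rewrite sumr_ge0.
have K_gt0 : 0 < K by rewrite ltr_wpDl // addr_ge0.
(* [|y|^2] grows like [exp (a t)] and [|y| <= K |x|], so taking square roots halves the exponent.
   The summand 1 makes [K] positive. *)
exists (Num.sqrt c / K), (a / 2); split; rewrite ?divr_gt0 ?sqrtr_gt0//.
near=> t.
have t0t : t0 <= t by near: t; apply: nbhs_pinfty_ge; rewrite num_real.
have Tt : T <= t by near: t; apply: nbhs_pinfty_ge; rewrite num_real.
have x_ge0 : 0 <= l2norm (x t) by exact: sqrtr_ge0.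
rewrite mulrAC ler_pdivrMr//.
rewrite -(@ler_pXn2r _ 2)// ?nnegrE ?mulr_ge0 ?sqrtr_ge0 ?expR_ge0 ?(ltW K_gt0)//.
rewrite exprMn sqr_sqrtr ?(ltW c_gt0)// -expRM_natl mulrA [2 * _]mulrC divfK//.
apply: le_trans (Hc t Tt) _.
have [-> ->] := ey _ t0t.
have n1 := norm_functional_le q1 (x t); have n2 := norm_functional_le q2 (x t).
apply: (@le_trans _ _ ((`|(q1 *m x t) 0 0| + `|(q2 *m x t) 0 0|) ^+ 2)).
  by rewrite sqrrD !real_normK ?num_real// lerD2r lerDl mulrn_wge0.
rewrite ler_pXn2r ?nnegrE ?addr_ge0 ?mulr_ge0 ?(ltW K_gt0)//.
apply: le_trans (lerD n1 n2) _.
by rewrite -mulrDl mulrC ler_wpM2l// lerDl.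
Unshelve. all: by end_near. Qed.

Hypothesis w_neq0 : w != 0.

(** One non-growing solution with nonzero projected data serves as a reference: vanishing of the
    Wronskian against it is a complex linear equation on all non-growing data. Without such a
    reference, [q1] and [q2] themselves annihilate those data. *)
Lemma non_growing_data_hyperplane :
  exists2 l : 'rV[R]_(n + n), l != 0 &
    forall z x v, ivp_solution t0 G z x v -> ~ grows_exponentially x ->
      (l *m z) 0 0 = 0.
Proof.
have q_neq0 : q1 != 0 \/ q2 != 0.
  have [q10|] := eqVneq q1 0; last by left.
  right; apply: contra_neq w_neq0 => q20; apply/rowP => j.
  move/rowP: q10 => /(_ j); move/rowP: q20 => /(_ j); rewrite !mxE.
  by case: (w 0 j) => /= c d -> ->.
have bad z x v : ivp_solution t0 G z x v -> ~ grows_exponentially x ->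
    exists y1 y2 v1 v2 : R -> R, [/\ damped_osc t0 a b y1 y2 v1 v2,
      decays_quadratically y1 y2 v1 v2 &
      [/\ y1 t0 = (q1 *m usubmx z) 0 0, y2 t0 = (q2 *m usubmx z) 0 0,
          v1 t0 = (q1 *m dsubmx z) 0 0 & v2 t0 = (q2 *m dsubmx z) 0 0]].
  move=> [sol <- <-] ng.
  have [y1 [y2 [v1 [v2 [osc e]]]]] := damped_osc_of_solution sol.
  exists y1, y2, v1, v2; split => //; last exact: e.
  have [[c [c_gt0 [T HT]]]|//] := damped_osc_growth_or_decay t0_gt0 a_gt0 osc.
  exfalso; apply: ng.
  apply: (grows_exponentially_of_functionals c_gt0 _ HT) => t /e[].
  by split.
pose A (z : 'cV[R]_(n + n)) := [/\ (q1 *m usubmx z) 0 0 = 0, (q2 *m usubmx z) 0 0 = 0,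
  (q1 *m dsubmx z) 0 0 = 0 & (q2 *m dsubmx z) 0 0 = 0] : Prop.
have lE (r s : 'rV[R]_n) (z : 'cV[R]_(n + n)) : (row_mx r s *m z) 0 0 =
    (r *m usubmx z) 0 0 + (s *m dsubmx z) 0 0.
  by rewrite -[in LHS](vsubmxK z) mul_row_col mxE.
have [[z' [x' [v' [sol' ng' nA]]]]|noA] := pselect (exists z x v,
    [/\ ivp_solution t0 G z x v, ~ grows_exponentially x & ~ A z]); last first.
  exists (if q1 != 0 then row_mx q1 0 else row_mx q2 0).
    case: ifPn => q10; rewrite row_mx_eq0 negb_and eqxx orbF ?q10//.
    by case: q_neq0 => //; rewrite (negbTE q10).
  move=> z x v sol ng; have [e1 e2 _ _] : A z.
    by apply: contrapT => nA; apply: noA; exists z, x, v.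
  by case: ifP => _; rewrite lE mul0mx [X in _ + X]mxE addr0.
have [z1 [z2 [u1 [u2 [osc' dec' [ez1 ez2 eu1 eu2]]]]]] := bad _ _ _ sol' ng'.
(* [l1] and [l2] are the real and imaginary parts of the Wronskian against the reference solution,
   as functionals of the initial data. *)
pose l1 := row_mx (u1 t0 *: q1 + - u2 t0 *: q2) (- z1 t0 *: q1 + - - z2 t0 *: q2).
pose l2 := row_mx (u2 t0 *: q1 + u1 t0 *: q2) (- z2 t0 *: q1 + - z1 t0 *: q2).
have linE (c d : R) (y : 'cV[R]_n) : ((c *: q1 + d *: q2) *m y) 0 0 =
    c * (q1 *m y) 0 0 + d * (q2 *m y) 0 0.
  by rewrite mulmxDl -!scalemxAl mxE [X in X + _]mxE [X in _ + X]mxE.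
have l_eq0 z x v : ivp_solution t0 G z x v -> ~ grows_exponentially x ->
    (l1 *m z) 0 0 = 0 /\ (l2 *m z) 0 0 = 0.
  move=> sol ng.
  have [y1 [y2 [v1 [v2 [osc dec [ey1 ey2 ev1 ev2]]]]]] := bad _ _ _ sol ng.
  have [W1 W2] := damped_osc_wronskian t0_gt0 osc osc' dec dec'.
  rewrite !lE !linE -ey1 -ey2 -ev1 -ev2; split; [move: W1 | move: W2]; lra.
have [l1_eq0|l1_neq0] := eqVneq l1 0; last first.
  by exists l1 => // z x v sol /(l_eq0 _ _ _ sol)[].
exists l2; last by move=> z x v sol /(l_eq0 _ _ _ sol)[].
apply/eqP => l2_eq0.
(* The two premises say [(c + i d) w = 0], and [w] is nonzero. Hence [l1 = l2 = 0] would make the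
   projected reference data vanish. *)
have indep c d : c *: q1 + - d *: q2 = 0 -> d *: q1 + c *: q2 = 0 ->
    c = 0 /\ d = 0.
  move=> e1 e2.
  have n1 : (c ^+ 2 + d ^+ 2) *: q1 = 0.
    transitivity (c *: (c *: q1 + - d *: q2) + d *: (d *: q1 + c *: q2)).
      by apply/rowP => j; rewrite !mxE; ring.
    by rewrite e1 e2 !scaler0 addr0.
  have n2 : (c ^+ 2 + d ^+ 2) *: q2 = 0.
    transitivity (c *: (d *: q1 + c *: q2) - d *: (c *: q1 + - d *: q2)).
      by apply/rowP => j; rewrite !mxE; ring.
    by rewrite e1 e2 !scaler0 subr0.
  have : c ^+ 2 + d ^+ 2 = 0.
    move/eqP: n1; move/eqP: n2; rewrite !scaler_eq0.
    case: q_neq0 => /negbTE ->; rewrite orbF; first by move=> _ /eqP.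
    by move=> /eqP.
  move=> /eqP; rewrite paddr_eq0 ?sqr_ge0// !expf_eq0 /=.
  by move=> /andP[/eqP -> /eqP ->].
move/eqP: l1_eq0; move/eqP: l2_eq0; rewrite !row_mx_eq0.
move=> /andP[/eqP e21 /eqP e22] /andP[/eqP e11 /eqP e12].
have [u10 u20] := indep _ _ e11 e21.
have [/eqP z10 /eqP z20] := indep _ _ e12 e22.
apply: nA; rewrite /A -ez1 -ez2 -eu1 -eu2; split => //; apply/eqP.
  by rewrite -oppr_eq0.
by rewrite -oppr_eq0.
Qed.

End left_eigenvector.

(** * Null sets *)

Lemma sub_lebesgue_null (R : realType) n (A B : set 'cV[R]_n) :
  A `<=` B -> lebesgue_null B -> lebesgue_null A.
Proof.
move=> AB nullB e /nullB[a [b [ab BC vol]]].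
by exists a, b; split => //; exact: subset_trans BC.
Qed.

Lemma box_volume_ge0 (R : realType) n (a b : 'cV[R]_n) :
  (forall i, a i 0 <= b i 0) -> 0 <= \prod_i (b i 0 - a i 0).
Proof. by move=> ab; rewrite prodr_ge0// => i _; rewrite subr_ge0. Qed.

(** The [k]-th set gets boxes of total volume at most [e / 2 ^ k.+1]; a bijection of [nat] with
    [nat * nat] turns the double family into one sequence, and nonnegativity allows the
    resummation. *)
Lemma lebesgue_null_bigcup (R : realType) n (A : nat -> set 'cV[R]_n) :
  (forall k, lebesgue_null (A k)) -> lebesgue_null (\bigcup_k A k).
Proof.
move=> nullA e e0.
have e2_gt0 k : 0 < e / (2 ^ k.+1)%:R by rewrite divr_gt0// ltr0n expn_gt0.
have /choice[a] := fun k => nullA k _ (e2_gt0 k).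
move=> /choice[b ab].
have /card_esym/ppcard_eqP[f] := card_nat2.
pose vol (kl : nat * nat) : \bar R :=
  (\prod_i (b kl.1 kl.2 i 0 - a kl.1 kl.2 i 0))%:E.
have vol_ge0 kl : (0 <= vol kl)%E.
  by rewrite lee_fin box_volume_ge0//; case: (ab kl.1).
exists (fun m => a (f m).1 (f m).2), (fun m => b (f m).1 (f m).2); split.
- by move=> m i; case: (ab (f m).1).
- move=> x [k _]; have [_ cov _] := ab k; move=> /cov[l _ xl].
  by exists (f^-1%FUN (k, l)) => //=; rewrite invK ?inE.
rewrite -[leLHS]/(\sum_(0 <= m <oo) (vol \o f) m)%E.
rewrite nneseries_esumT => [|m]; last exact: vol_ge0.
rewrite -(@reindex_esum _ _ _ setT setT f vol)//.
rewrite [X in \esum_(_ in X) _](_ : _ = [set: nat] `*`` (fun=> [set: nat])).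
  rewrite -(@esum_esum _ _ _ _ _ (fun k l => vol (k, l)))//.
  rewrite -nneseries_esumT => [|k]; last by apply: esum_ge0.
  apply: le_trans (epsilon_trick0 xpredT (ltW e0)).
  apply: lee_nneseries => [k _ _|k _]; first exact: esum_ge0.
  by rewrite -nneseries_esumT//; have [] := ab k.
by apply/seteqP; split.
Qed.

(** The finite family is enumerated and padded with the degenerate box at 0. The index [j] witnesses
    a positive dimension, so that this box has volume 0 and not the empty product 1. *)
Lemma finite_box_cover (R : realType) n (j : 'I_n) (I : finType)
    (a b : I -> 'cV[R]_n) (A : set 'cV[R]_n) (e : R) :
  (forall f i, a f i 0 <= b f i 0) ->
  A `<=` \bigcup_f [set x | forall i, a f i 0 <= x i 0 <= b f i 0] ->
  \sum_f \prod_i (b f i 0 - a f i 0) <= e ->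
  exists a' b' : nat -> 'cV[R]_n,
    [/\ forall k i, a' k i 0 <= b' k i 0,
        A `<=` \bigcup_k [set x | forall i, a' k i 0 <= x i 0 <= b' k i 0] &
        (\sum_(0 <= k <oo) (\prod_i (b' k i 0 - a' k i 0))%:E <= e%:E)%E].
Proof.
move=> ab cov vol.
pose get (g : I -> 'cV[R]_n) k : 'cV[R]_n :=
  if insub k is Some m then g (enum_val (m : 'I_#|I|)) else 0.
have getE g k (kI : (k < #|I|)%N) : get g k = g (enum_val (Ordinal kI)).
  by rewrite /get insubT.
have get0 g k : (#|I| <= k)%N -> get g k = 0.
  by move=> Ik; rewrite /get insubN// -leqNgt.
have get_le k i : get a k i 0 <= get b k i 0.
  have [kI|kI] := ltnP k #|I|; last by rewrite !(get0 _ _ kI).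
  by rewrite !(getE _ _ kI).
exists (get a), (get b); split => //.
  move=> x /cov[f _ xf]; exists (enum_rank f) => //= i.
  rewrite !(getE _ _ (ltn_ord _)) (_ : Ordinal _ = enum_rank f) ?enum_rankK//.
  exact: val_inj.
rewrite (@nneseries_split _ _ _ #|I|) => [|k _]; last first.
  by rewrite lee_fin box_volume_ge0.
rewrite [X in (_ + X)%E]eseries0 => [|k Ik _]; last first.
  by rewrite (bigD1 j)//= !get0// mxE subrr mul0r.
rewrite adde0 add0n sumEFin lee_fin; apply: le_trans vol.
rewrite big_mkord (reindex enum_rank)/=; last exact: onW_bij (@enum_rank_bij I).
rewrite le_eqVlt; apply/orP; left; apply/eqP; apply: eq_bigr => f _.
apply: eq_bigr => i _.
rewrite !(getE _ _ (ltn_ord _)) (_ : Ordinal _ = enum_rank f) ?enum_rankK//.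
exact: val_inj.
Qed.

Lemma grid_index (R : realType) (h y : R) (K : nat) : 0 <= y ->
  y <= h * K.+1%:R -> exists m : 'I_K.+1, h * m%:R <= y <= h * m%:R + h.
Proof.
move=> y0; elim: K => [|K IH] yK.
  by exists ord0; rewrite mulr0 y0 add0r -[h]mulr1.
have [yK'|yK'] := leP y (h * K.+1%:R).
  have [m hm] := IH yK'; by exists (widen_ord (leqnSn _) m).
by exists ord_max; rewrite (ltW yK')/= -[X in _ + X]mulr1 -mulrDr natr1.
Qed.

(** Where [l 0 j] is nonzero, the equation expresses [z j 0] through the other coordinates. A
    bounded piece is covered by a grid of mesh [h] in those coordinates, times an interval of length
    proportional to [h]; the total volume is thus proportional to [h]. *)
Lemma lebesgue_null_hyperplane (R : realType) n (l : 'rV[R]_n) : l != 0 ->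
  lebesgue_null [set z : 'cV[R]_n | (l *m z) 0 0 = 0].
Proof.
move=> /rV0Pn[j lj].
pose A M := [set z : 'cV[R]_n | (l *m z) 0 0 = 0 /\ forall i, `|z i 0| <= M.+1%:R].
apply: (@sub_lebesgue_null _ _ _ (\bigcup_M A M)).
  move=> z /= lz; exists (Num.bound (\sum_i `|z i 0|)) => //; split => // i.
  rewrite (@le_trans _ _ (\sum_i `|z i 0|))//.
    by rewrite (bigD1 i)//= lerDl sumr_ge0.
  by apply/ltW/(lt_trans (archi_boundP _)); rewrite ?ltr_nat// sumr_ge0.
apply: lebesgue_null_bigcup => M e e0.
pose c k := - l 0 (lift j k) / l 0 j.
pose S := \sum_k `|c k|.
have S_ge0 : 0 <= S by rewrite sumr_ge0.
(* [D / K.+1] will be the total volume of the cover, and [K] is chosen to bring it below [e]; [h]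
   divides [[- M.+1, M.+1]] into [K.+1] intervals. *)
pose D := 4 * S * M.+1%:R * (2 * M.+1%:R) ^+ n.-1.
have D_ge0 : 0 <= D by rewrite !mulr_ge0// exprn_ge0// mulr_ge0.
pose K := Num.bound (D / e).
pose h : R := 2 * M.+1%:R / K.+1%:R.
have h_ge0 : 0 <= h by rewrite divr_ge0// mulr_ge0.
pose corner (f : {ffun 'I_n.-1 -> 'I_K.+1}) k := - M.+1%:R + h * (f k)%:R.
pose a f : 'cV[R]_n := \col_i
  if unlift j i is Some k then corner f k else \sum_k c k * corner f k - S * h.
pose b f : 'cV[R]_n := \col_i
  if unlift j i is Some k then corner f k + h
  else \sum_k c k * corner f k + S * h.
apply: (@finite_box_cover _ _ j _ a b).
- move=> f i; rewrite !mxE; case: unlift => [k|]; first by rewrite lerDl.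
  by rewrite lerD2l ge0_cp ?mulr_ge0.
- move=> z [lz zM].
  have zj : z j 0 = \sum_k c k * z (lift j k) 0.
    move: lz; rewrite mxE (bigD1_ord j)//= => /eqP; rewrite addr_eq0 => /eqP lz.
    apply: (mulfI lj); rewrite lz mulr_sumr -sumrN; apply: eq_bigr => k _.
    by rewrite /c mulrCA; field.
  have /fin_all_exists[f hf] (k : 'I_n.-1) : exists m : 'I_K.+1,
      h * m%:R <= z (lift j k) 0 + M.+1%:R <= h * m%:R + h.
    have := zM (lift j k); rewrite ler_norml => /andP[z1 z2].
    apply: grid_index; first by rewrite -lerBlDr sub0r.
    by rewrite /h divfK// mulr2n mulrDl !mul1r lerD2r.
  exists (finfun f) => //= i; rewrite !mxE; case: unliftP => [k ->|->].
    by rewrite /corner ffunE; have /andP[? ?] := hf k; apply/andP; split; lra.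
  (* Moving each other coordinate by at most [h] from the corner moves [z j 0] by at most
     [S * h]. *)
  rewrite -ler_distl zj -sumrB (le_trans (ler_norm_sum _ _ _))// mulr_suml.
  apply: ler_sum => k _; rewrite -mulrBr normrM ler_wpM2l// /corner ffunE.
  by have /andP[? ?] := hf k; rewrite ger0_norm; lra.
(* The [K.+1 ^ n.-1] boxes have total volume [D / K.+1]. *)
have volE f : \prod_i (b f i 0 - a f i 0) = 2 * S * h * h ^+ n.-1.
  rewrite (bigD1_ord j)//= !mxE unlift_none; congr (_ * _); first by ring.
  rewrite (eq_bigr (fun=> h)) => [|k _]; first by rewrite prodr_const card_ord.
  by rewrite !mxE liftK addrC addKr.
under eq_bigr do rewrite volE.
rewrite sumr_const card_ffun !card_ord -[_ *+ (_ ^ _)]mulr_natl natrX.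
have -> : K.+1%:R ^+ n.-1 * (2 * S * h * h ^+ n.-1) = D / K.+1%:R.
  rewrite mulrCA -exprMn mulrC {1}/h [K.+1%:R * _]mulrC divfK// /h /D.
  by field; rewrite nat1r pnatr_eq0.
rewrite ler_pdivrMr// mulrC -ler_pdivrMr//.
by apply/ltW/(lt_trans (archi_boundP _)); rewrite ?ltr_nat// divr_ge0// ltW.
Qed.

(** * Existence of solutions *)

Lemma slope_cvg_is_derive (R : realType) (F : R -> R) (t l : R) :
  is_derive t 1 F l -> (s - t)^-1 * (F s - F t) @[s --> t^'] --> l.
Proof.
move=> [Fd Fl].
have H : h^-1 *: ((F \o shift t) (h *: 1) - F t) @[h --> 0^'] --> l.
  by rewrite -Fl; exact: Fd.
move/cvgrPdist_lt : H => H; apply/cvgrPdist_lt => e /H.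
move=> /nbhs_ballP[d /= d0 {}H]; apply/nbhs_ballP; exists d => //= s.
rewrite /ball/= distrC => std st; have := H (s - t); rewrite /ball/= sub0r normrN.
by move=> /(_ std); rewrite subr_eq0 /GRing.scale/= mulr1 subrK; exact.
Qed.

(* The power series with coefficients [c] has radius of convergence at least 1. *)
Definition disc_bounded (R : realType) (c : nat -> R) :=
  forall rho : R, 0 < rho < 1 -> exists B : R, forall k, `|c k| * rho ^+ k <= B.

(** The bound is taken at a radius [s] between [rho] and 1; the factor [k.+1] is absorbed by
    [(s / rho) ^+ k.+1] through Bernoulli's inequality. *)
Lemma disc_bounded_diffs (R : realType) (c : nat -> R) :
  disc_bounded c -> disc_bounded (pseries_diffs c).
Proof.
move=> cB rho /andP[rho0 rho1].
pose s := (1 + rho) / 2.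
have s01 : 0 < s < 1 by rewrite /s; apply/andP; split; lra.
have [B HB] := cB s s01; have /andP[s0 s1] := s01.
have rhos : rho < s by rewrite /s; lra.
pose d := s / rho - 1.
have d0 : 0 < d by rewrite subr_gt0 ltr_pdivlMr// mul1r.
have bern k : k%:R * d <= (1 + d) ^+ k.
  elim: k => [|k IH]; first by rewrite mul0r.
  rewrite -natr1 mulrDl mul1r exprS mulrDl mul1r lerD//.
  by rewrite ler_peMr ?(ltW d0)// exprn_ege1// lerDl ltW.
exists (B / (d * rho)) => k.
rewrite /pseries_diffs normrM normr_nat ler_pdivlMr ?mulr_gt0//.
apply: le_trans (HB k.+1).
have -> : s = rho * (1 + d) by rewrite /d addrC subrK mulrC divfK// gt_eqF.
rewrite exprMn.
have -> : k.+1%:R * `|c k.+1| * rho ^+ k * (d * rho) =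
    `|c k.+1| * (rho ^+ k.+1 * (k.+1%:R * d)) by rewrite exprS; ring.
by rewrite ler_wpM2l// ler_wpM2l ?exprn_ge0// ltW.
Qed.

Lemma disc_bounded_cvg (R : realType) (c : nat -> R) (u : R) :
  disc_bounded c -> `|u| < 1 -> cvgn (pseries c u).
Proof.
move=> cB u1; pose s := (1 + `|u|) / 2.
have u0 := normr_ge0 u.
have s01 : 0 < s < 1 by rewrite /s; apply/andP; split; lra.
have us : `|u| < s by rewrite /s; lra.
have [B HB] := cB s s01; have /andP[s0 s1] := s01.
apply: normed_cvg; apply: (@series_le_cvg _ _ (geometric B (`|u| / s))).
- by move=> n; exact: normr_ge0.
- move=> n; rewrite /geometric /= mulr_ge0 ?exprn_ge0 ?divr_ge0 ?(ltW s0)//.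
  by rewrite (le_trans _ (HB 0%N))// mulr_ge0.
- move=> n; rewrite /geometric/= normrM normrX expr_div_n mulrA.
  rewrite ler_pdivlMr ?exprn_gt0// mulrAC ler_wpM2r ?exprn_ge0//.
- apply: is_cvg_geometric_series.
  by rewrite ger0_norm ?divr_ge0 ?(ltW s0)// ltr_pdivrMr// mul1r.
Qed.

Lemma is_derive_pseries (R : realType) (c : nat -> R) (u : R) :
  disc_bounded c -> `|u| < 1 ->
  is_derive u 1 (fun x => limn (pseries c x)) (limn (pseries (pseries_diffs c) u)).
Proof.
move=> cB u1; pose s := (1 + `|u|) / 2.
have u0 := normr_ge0 u.
have s0 : 0 < s by rewrite /s; lra.
have s1 : `|s| < 1 by rewrite ger0_norm ?ltW// /s; lra.
have dB := disc_bounded_diffs cB; have ddB := disc_bounded_diffs dB.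
apply: (@pseries_snd_diffs _ _ s); last by rewrite (ger0_norm (ltW s0)) /s; lra.
- exact: disc_bounded_cvg cB s1.
- exact: disc_bounded_cvg dB s1.
- exact: disc_bounded_cvg ddB s1.
Qed.

Lemma pseries_at0 (R : realType) (c : nat -> R) : limn (pseries c 0) = c 0%N.
Proof.
apply: lim_near_cst => //; near=> n.
have n0 : (0 < n)%N by near: n; exists 1%N.
rewrite -(prednK n0) /pseries /series/= big_nat_recl//= mulr1 big1 ?addr0// => i _.
by rewrite exprS mul0r mulr0.
Unshelve. all: by end_near. Qed.

(** Division of a power series by [1 - u] replaces its coefficients by their partial sums. *)
Lemma pseries_partial_sums (R : realType) (c p : nat -> R) (u : R) :
  p 0%N = c 0%N -> (forall k, p k.+1 = p k + c k.+1) ->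
  disc_bounded c -> disc_bounded p -> `|u| < 1 ->
  (1 - u) * limn (pseries p u) = limn (pseries c u).
Proof.
move=> p0 pS cB pB u1.
have cc := disc_bounded_cvg cB u1; have pc := disc_bounded_cvg pB u1.
apply/esym/cvg_lim => //; rewrite -cvg_shiftS mulrBl mul1r.
have -> : (fun n => pseries c u n.+1) =
    (fun n => pseries p u n.+1) \- (fun n => u * pseries p u n).
  apply/funext => n /=; elim: n => [|n IH].
    by rewrite /pseries /series/= !big_nat1 big_geq// mulr0 subr0 p0.
  rewrite /pseries /series/= in IH *.
  rewrite big_nat_recr//= IH [in RHS]big_nat_recr//= [X in _ = _ - _ * X]big_nat_recr//=.
  by rewrite pS exprS; ring.
apply: cvgB; last exact: cvgMl_tmp.
by rewrite (cvg_shiftS (pseries p u)).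
Qed.

(** * Coefficients of the power series solution and their growth *)

Lemma coord_le_norm (R : realType) n (z : 'cV[R]_n) i : `|z i 0| <= `|z|.
Proof.
by rewrite [leRHS]/Num.norm/= mx_normrE; apply: (le_bigmax _ _ (i, 0)).
Qed.

Lemma mulmx_norm_bound (R : realType) n (H : 'M[R]_n) :
  exists2 L : R, 0 <= L & forall y : 'cV[R]_n, `|H *m y| <= L * `|y|.
Proof.
exists (\sum_i \sum_j `|H i j|) => [|y].
  by rewrite sumr_ge0// => i _; rewrite sumr_ge0.
rewrite [leLHS]/Num.norm/= mx_normrE; apply/bigmax_leP; split => [|[i j] _ /=].
  by rewrite mulr_ge0// sumr_ge0// => i _; rewrite sumr_ge0.
rewrite ord1 mxE (le_trans (ler_norm_sum _ _ _))//.
rewrite [X in _ <= X * _](bigD1 i)//= mulrDl ler_wpDr//.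
  by rewrite mulr_ge0// sumr_ge0// => k _; rewrite sumr_ge0.
rewrite mulr_suml ler_sum// => k _; rewrite normrM ler_wpM2l//.
exact: coord_le_norm.
Qed.

(* Coefficients of a power series solution of [(1 - u)^3 x_uu = H x]: [p], [q] and
   [r] are the coefficients of [x / (1 - u)^j] for [j = 1, 2, 3], and
   [x_uu = H r]. *)
Lemma coef_recursion (R : realType) n (H : 'M[R]_n) (x0 x1 : 'cV[R]_n) :
  exists x p q r : nat -> 'cV[R]_n,
  [/\ x 0%N = x0 /\ x 1%N = x1,
      p 0%N = x 0%N /\ forall k, p k.+1 = p k + x k.+1,
      q 0%N = p 0%N /\ forall k, q k.+1 = q k + p k.+1,
      r 0%N = q 0%N /\ forall k, r k.+1 = r k + q k.+1 &
      forall k, x k.+2 = (k.+2%:R * k.+1%:R)^-1 *: (H *m r k)].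
Proof.
(* The state at [k] is [(x k, x k.+1, (p k, q k, r k))]: two coefficients are carried because [r k]
   determines [x k.+2]. *)
pose step k (s : 'cV[R]_n * 'cV[R]_n * ('cV[R]_n * 'cV[R]_n * 'cV[R]_n)) :=
  let: (x, x', (p, q, r)) := s in
  (x', (k.+2%:R * k.+1%:R)^-1 *: (H *m r),
   (p + x', q + (p + x'), r + (q + (p + x')))).
pose st := fix st k := if k is k'.+1 then step k' (st k')
  else (x0, x1, (x0, x0, x0)).
exists (fun k => (st k).1.1), (fun k => (st k).2.1.1), (fun k => (st k).2.1.2),
  (fun k => (st k).2.2); split => //.
- split=> // k /=.
  by case: (st k) => [[a b] [[p q] r]].
- by split=> // k /=; case: (st k) => [[a b] [[p q] r]].
- by split=> // k /=; case: (st k) => [[a b] [[p q] r]].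
- by move=> k /=; case: (st k) => [[a b] [[p q] r]].
Qed.

(** The induction step is [rho * B / (1 - rho) + B = B / (1 - rho)]. The horizon [K] allows use
    inside an induction in which [x] is bounded only so far. *)
Lemma partial_sums_bound (R : realType) (V : normedModType R) (x p : nat -> V)
    (rho B : R) (K : nat) : 0 < rho < 1 ->
  p 0%N = x 0%N -> (forall k, p k.+1 = p k + x k.+1) ->
  (forall k, (k <= K)%N -> `|x k| * rho ^+ k <= B) ->
  forall k, (k <= K)%N -> `|p k| * rho ^+ k <= B / (1 - rho).
Proof.
move=> /andP[rho0 rho1] p0 pS xB.
have B0 : 0 <= B by rewrite (le_trans _ (xB 0%N _))// mulr_ge0// exprn_ge0// ltW.
have r1 : 0 < 1 - rho by rewrite subr_gt0.
elim=> [_|k IH kK].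
  rewrite p0 (le_trans (xB _ _))// ler_pdivlMr// ler_piMr//.
  by rewrite gerBl ltW.
rewrite pS; apply: (@le_trans _ _ ((`|p k| + `|x k.+1|) * rho ^+ k.+1)).
  by rewrite ler_wpM2r ?ler_normD// exprn_ge0// ltW.
rewrite mulrDl exprS mulrCA -exprS.
apply: le_trans (lerD (ler_wpM2l (ltW rho0) (IH (ltnW kK))) (xB _ kK)) _.
by rewrite le_eqVlt; apply/orP; left; apply/eqP; field; rewrite gt_eqF.
Qed.

(** Three partial summations and [H] cost the factor [C = L / (1 - rho)^3], while the recursion
    divides by [k.+2 * k.+1]. Past [k0 >= C] a bound [B] therefore propagates; [B] is the sum of the
    earlier terms so as to dominate each of them. *)
Lemma coef_recursion_bound (R : realType) n (H : 'M[R]_n)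
    (x p q r : nat -> 'cV[R]_n) (rho : R) : 0 < rho < 1 ->
  p 0%N = x 0%N -> (forall k, p k.+1 = p k + x k.+1) ->
  q 0%N = p 0%N -> (forall k, q k.+1 = q k + p k.+1) ->
  r 0%N = q 0%N -> (forall k, r k.+1 = r k + q k.+1) ->
  (forall k, x k.+2 = (k.+2%:R * k.+1%:R)^-1 *: (H *m r k)) ->
  exists B, forall k, `|x k| * rho ^+ k <= B.
Proof.
move=> rho01 p0 pS q0 qS r0 rS xS; have /andP[rho0 rho1] := rho01.
have [L L0 HL] := mulmx_norm_bound H.
have r1 : 0 < 1 - rho by rewrite subr_gt0.
pose C := L / (1 - rho) ^+ 3.
have C0 : 0 <= C by rewrite divr_ge0// exprn_ge0// ltW.
pose k0 := Num.bound C.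
pose B := \sum_(j < k0.+2) `|x j| * rho ^+ j.
have term_ge0 j : 0 <= `|x j| * rho ^+ j by rewrite mulr_ge0// exprn_ge0// ltW.
have B0 : 0 <= B by rewrite sumr_ge0.
have small k : (k < k0.+2)%N -> `|x k| * rho ^+ k <= B.
  by move=> kk0; rewrite /B (bigD1 (Ordinal kk0))//= lerDl sumr_ge0.
exists B => k.
suff : forall j, (j <= k)%N -> `|x j| * rho ^+ j <= B by apply.
elim: k => [|k IH] j; first by rewrite leqn0 => /eqP ->; exact: small.
rewrite leq_eqVlt ltnS => /orP[/eqP ->{j}|]; last exact: IH.
have [kk0|] := ltnP k.+1 k0.+2; first exact: small.
case: k IH => [|k] IH // kk0.
have pB := partial_sums_bound rho01 p0 pS IH.
have qB := partial_sums_bound rho01 q0 qS pB.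
have rB := partial_sums_bound rho01 r0 rS qB (leqnSn k).
rewrite xS normrZ ger0_norm ?invr_ge0 ?mulr_ge0//.
rewrite -mulrA ler_pdivrMl ?mulr_gt0//.
apply: le_trans (ler_wpM2r (exprn_ge0 _ (ltW rho0)) (HL (r k))) _.
apply: (@le_trans _ _ (L * (`|r k| * rho ^+ k))).
  rewrite -mulrA ler_wpM2l// ler_wpM2l//.
  by rewrite ler_wiXn2l// ?ltW// -addn2 leq_addr.
apply: le_trans (ler_wpM2l L0 rB) _.
have -> : L * (B / (1 - rho) / (1 - rho) / (1 - rho)) = C * B.
  by rewrite /C; field; rewrite gt_eqF.
rewrite ler_wpM2r//; apply: le_trans (ltW (archi_boundP C0)) _.
rewrite -natrM ler_nat -/k0; apply: leq_trans (leq_pmulr _ _) => //.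
by rewrite ltnS in kk0; exact: leq_trans (leqnSn _) (leq_trans kk0 (leqnSn _)).
Qed.

(** * From the power series to the initial value problem *)

Lemma has_deriv_on_cV (R : realType) n (D : set R) (f : R -> 'cV[R]_n) (t : R)
    (l : 'cV[R]_n) :
  (forall i, is_derive t 1 (fun s => f s i 0) (l i 0)) -> has_deriv_on D f t l.
Proof.
move=> df; apply: cvg_within_filter; apply: cvg_cV => i.
under eq_cvg do rewrite !mxE.
exact: slope_cvg_is_derive.
Qed.

Lemma pseries_mulmx (R : realType) n (H : 'M[R]_n) (r : nat -> 'cV[R]_n) i u :
  (forall j, cvgn (pseries (fun k => r k j 0) u)) ->
  limn (pseries (fun k => (H *m r k) i 0) u) =
  \sum_j H i j * limn (pseries (fun k => r k j 0) u).
Proof.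
move=> rc; apply/cvg_lim => //.
have -> : pseries (fun k => (H *m r k) i 0) u =
    fun m => \sum_j H i j * pseries (fun k => r k j 0) u m.
  apply/funext => m; rewrite /pseries /series/=.
  under eq_bigr do rewrite mxE mulr_suml.
  rewrite exchange_big; apply: eq_bigr => j _; rewrite mulr_sumr.
  by apply: eq_bigr => k _; rewrite mulrA.
apply: (@cvg_big _ _ +%R) => [|j _]; first exact: add_continuous.
exact: cvgMl_tmp.
Qed.

Lemma is_derive_inv (R : realType) (t : R) : t != 0 ->
  is_derive t 1 (fun s : R => s^-1) (- t^-1 ^+ 2).
Proof.
move=> t0; have := @is_deriveV R id t 1 1 t0 (is_derive_id _ _).
by rewrite /GRing.scale/= mulr1 exprVn.
Qed.

Lemma ivp_solution_exists (R : realType) n (t0 : R) (G : 'M[R]_n)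
    (z : 'cV[R]_(n + n)) : 0 < t0 -> exists x v, ivp_solution t0 G z x v.
Proof.
move=> t0_gt0.
(* At [t0] the derivative of [u] is [2 / t0], so the first coefficient is [t0 / 2] times the initial
   velocity. *)
have [x [p [q [r [[x0 x1] [p0 pS] [q0 qS] [r0 rS] xS]]]]] :=
  coef_recursion (- (t0 ^+ 2 / 4) *: G) (usubmx z) ((t0 / 2) *: dsubmx z).
set H := _ *: G in xS.
pose bounded (y : nat -> 'cV[R]_n) :=
  forall rho : R, 0 < rho < 1 -> exists B : R, forall k, `|y k| * rho ^+ k <= B.
have xB : bounded x.
  by move=> rho rho01; exact: (coef_recursion_bound rho01 p0 pS q0 qS r0 rS xS).
have sumB (y s : nat -> 'cV[R]_n) : s 0%N = y 0%N ->
    (forall k, s k.+1 = s k + y k.+1) -> bounded y -> bounded s.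
  move=> s0 sS yB rho rho01; have [B HB] := yB rho rho01.
  exists (B / (1 - rho)) => k.
  exact: (@partial_sums_bound _ _ _ _ _ _ k rho01 s0 sS (fun j _ => HB j)).
have pB := sumB _ _ p0 pS xB; have qB := sumB _ _ q0 qS pB.
have rB := sumB _ _ r0 rS qB.
have coord_bounded y i : bounded y -> disc_bounded (fun k => y k i 0).
  move=> yB rho rho01; have [B HB] := yB rho rho01; exists B => k.
  apply: le_trans (HB k); rewrite ler_wpM2r ?coord_le_norm// exprn_ge0// ltW//.
  by case/andP: rho01.
pose c i k := x k i 0.
have cB i : disc_bounded (c i) := coord_bounded _ i xB.
have dcB i := disc_bounded_diffs (cB i).
pose X i u := limn (pseries (c i) u).
pose X1 i u := limn (pseries (pseries_diffs (c i)) u).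
pose X2 i u := limn (pseries (pseries_diffs (pseries_diffs (c i))) u).
(* Each factor [1 - u] undoes one partial summation, leading from [r] through [q] and [p] back to
   [x]. *)
have X2E i u : `|u| < 1 -> (1 - u) ^+ 3 * X2 i u = \sum_j H i j * X j u.
  move=> u1; rewrite /X2.
  have -> : pseries_diffs (pseries_diffs (c i)) = (fun k => (H *m r k) i 0).
    apply/funext => k; rewrite /pseries_diffs /c xS mxE.
    by rewrite mulrA [_.+1%:R * _]mulrC mulrA mulfV ?mul1r// mulf_neq0// pnatr_eq0.
  rewrite pseries_mulmx => [|j]; last exact/disc_bounded_cvg/u1/coord_bounded.
  rewrite mulr_sumr; apply: eq_bigr => j _; rewrite mulrCA; congr (_ * _).
  have sum_eq (y s : nat -> 'cV[R]_n) : s 0%N = y 0%N ->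
      (forall k, s k.+1 = s k + y k.+1) -> bounded y -> bounded s ->
      (1 - u) * limn (pseries (fun k => s k j 0) u) =
      limn (pseries (fun k => y k j 0) u).
    move=> s0 sS yB sB; apply: pseries_partial_sums u1.
    - by rewrite s0.
    - by move=> k; rewrite sS mxE.
    - exact: coord_bounded.
    - exact: coord_bounded.
  rewrite exprSr -mulrA (sum_eq _ _ r0 rS)// exprSr -mulrA (sum_eq _ _ q0 qS)//.
  by rewrite expr1 (sum_eq _ _ p0 pS).
pose u (t : R) := 1 - t0 ^+ 2 * t^-1 ^+ 2.
have u_lt1 t : t0 <= t -> `|u t| < 1.
  move=> t0t; have t_gt0 := lt_le_trans t0_gt0 t0t.
  have w0 : 0 < t0 * t^-1 by rewrite mulr_gt0 ?invr_gt0.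
  have w1 : t0 * t^-1 <= 1 by rewrite ler_pdivrMr ?mul1r.
  rewrite /u -exprMn ger0_norm ?subr_ge0 ?expr_le1 ?(ltW w0)//.
  by rewrite gtrBl exprn_gt0.
have du t : t0 <= t -> is_derive t 1 u (2 * t0 ^+ 2 * t^-1 ^+ 3).
  move=> t0t; have ? := is_derive_inv (lt0r_neq0 (lt_le_trans t0_gt0 t0t)).
  by apply: is_derive_eq; rewrite /GRing.scale/=; ring.
have dX i t : t0 <= t ->
    is_derive t 1 (X i \o u) (X1 i (u t) * (2 * t0 ^+ 2 * t^-1 ^+ 3)).
  move=> t0t; have dXu : is_derive (u t) 1 (X i) (X1 i (u t)).
    exact: is_derive_pseries (cB i) (u_lt1 t t0t).
  exact: is_derive1_comp dXu (du t t0t).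
have dX1 i t : t0 <= t ->
    is_derive t 1 (X1 i \o u) (X2 i (u t) * (2 * t0 ^+ 2 * t^-1 ^+ 3)).
  move=> t0t; have dXu : is_derive (u t) 1 (X1 i) (X2 i (u t)).
    exact: is_derive_pseries (dcB i) (u_lt1 t t0t).
  exact: is_derive1_comp dXu (du t t0t).
have u_t0 : u t0 = 0 by rewrite /u -exprMn mulfV ?gt_eqF// expr1n subrr.
exists (fun t => \col_i X i (u t)),
  (fun t => \col_i (X1 i (u t) * (2 * t0 ^+ 2 * t^-1 ^+ 3))); split; last first.
- apply/colP => i; rewrite mxE u_t0 /X1 pseries_at0 /pseries_diffs /c x1 !mxE.
  by field; rewrite gt_eqF.
- by apply/colP => i; rewrite mxE u_t0 /X pseries_at0 /c x0.
move=> t t0t; have t_gt0 := lt_le_trans t0_gt0 t0t; split.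
  apply: has_deriv_on_cV => i; rewrite mxE.
  by under eq_fun do rewrite mxE; exact: dX.
(* Chain rule: [x_uu u'^2 + x_u u'']. Since [u'' + (3/t) u' = 0], the friction cancels the second
   term, and [u'^2 = (4 / t0^2) (1 - u)^3] gives the equation. *)
exists (\col_i (X2 i (u t) * (2 * t0 ^+ 2 * t^-1 ^+ 3) ^+ 2 -
                X1 i (u t) * (6 * t0 ^+ 2 * t^-1 ^+ 4))); split.
  apply: has_deriv_on_cV => i; rewrite mxE.
  under eq_fun do rewrite mxE.
  have := dX1 i t t0t; have := is_derive_inv (lt0r_neq0 t_gt0) => ? ?.
  by apply: is_derive_eq; rewrite /GRing.scale/=; ring.
apply/colP => i; rewrite !mxE.
have -> : \sum_j G i j * (\col_i0 X i0 (u t)) j 0 =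
    - (4 / t0 ^+ 2) * \sum_j H i j * X j (u t).
  rewrite mulr_sumr; apply: eq_bigr => j _; rewrite !mxE.
  by field; rewrite gt_eqF.
rewrite -X2E ?u_lt1// (_ : 1 - u t = t0 ^+ 2 * t^-1 ^+ 2); last first.
  by rewrite /u; ring.
by field; rewrite !gt_eqF.
Qed.

(** * Bounded solutions *)

Lemma cvg0_of_sqr_bound (R : realType) (f : R -> R) (K T : R) :
  (forall t : R, T <= t -> t * f t ^+ 2 <= K) -> f t @[t --> +oo] --> (0 : R).
Proof.
move=> Hf; apply/cvgrPdist_lt => e e0; near=> t.
have Tt : T <= t by near: t; apply: nbhs_pinfty_ge; rewrite num_real.
have t0 : 0 < t by near: t; apply: nbhs_pinfty_gt; rewrite num_real.
have Kt : K / e ^+ 2 < t by near: t; apply: nbhs_pinfty_gt; rewrite num_real.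
rewrite sub0r normrN -(@ltr_pXn2r _ 2)// ?nnegrE ?(ltW e0)//.
rewrite real_normK ?num_real// -(@ltr_pM2l _ t)//.
apply: le_lt_trans (Hf t Tt) _.
by rewrite -ltr_pdivrMr// exprn_gt0.
Unshelve. all: by end_near. Qed.

Section undamped_mode.
Variables (R : realType) (t0 l : R) (Y V : R -> R).
Hypothesis t0_gt0 : 0 < t0.
Hypothesis dY : forall t : R, t0 <= t -> is_derive t 1 Y (V t).
Hypothesis dV : forall t : R, t0 <= t -> is_derive t 1 V (- (3 / t) * V t - l * Y t).

Let pos (t : R) : t0 <= t -> 0 < t. Proof. exact: lt_le_trans. Qed.

Lemma mode_energy_le (t : R) : t0 <= t ->
  l * Y t ^+ 2 + V t ^+ 2 <= l * Y t0 ^+ 2 + V t0 ^+ 2.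
Proof.
move=> t0t.
apply: (@derive_le0_nonincr _ t0 (fun s => l * Y s ^+ 2 + V s ^+ 2)
  (fun s => - (6 / s * V s ^+ 2))) => // s t0s.
  have := dY t0s; have := dV t0s => ? ?.
  by apply: is_derive_eq; rewrite /GRing.scale/=; ring.
by rewrite oppr_le0 mulr_ge0 ?sqr_ge0// divr_ge0// (ltW (pos t0s)).
Qed.

(** The energy's derivative [- (6/t) V^2] does not control [Y]; the added cross term [3 Y V]
    supplies the missing negative multiple of [Y^2]. *)
Lemma mode_energy_decay : 0 < l -> exists K T : R, forall t : R, T <= t ->
  t * (l * Y t ^+ 2 + V t ^+ 2) <= K.
Proof.
move=> l0; have [m m0 lm] : exists2 m : R, 0 < m & l * m = 1.
  by exists l^-1; rewrite ?invr_gt0// mulfV// gt_eqF.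
have [T1 [t0T1 T1_1 T1_m]] : exists T1 : R, [/\ t0 <= T1, 3 <= T1 & 3 * m <= T1].
  by have := t0_gt0; exists (t0 + 3 + 3 * m); split; lra.
(* Lyapunov function: [L' <= 0] once [9 / s] is below [4] and [4 l], and [L] is
   eventually at least [t / 2] times the energy. *)
pose L (t : R) := t * (l * Y t ^+ 2 + V t ^+ 2) + 3 * (Y t * V t).
have L_le (t : R) : T1 <= t -> L t <= L T1.
  move=> T1t; apply: (@derive_le0_nonincr _ T1 L (fun s =>
    - (2 * l * Y s ^+ 2) - 2 * V s ^+ 2 - 9 / s * (Y s * V s))) => // s T1s.
    have t0s : t0 <= s by lra.
    have s_neq0 := lt0r_neq0 (pos t0s).
    have := dY t0s; have := dV t0s => ? ?.
    by apply: is_derive_eq; rewrite /GRing.scale/=; field.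
  have t0s : t0 <= s by lra.
  have s0 := pos t0s.
  have s1 : 9 * s^-1 <= 4.
    suff : 9 <= 4 * s by rewrite ler_pdivrMr.
    by lra.
  have s2 : 9 * s^-1 <= 4 * l.
    have ls : 3 * m <= s by lra.
    have := ler_wpM2l (ltW l0) ls.
    rewrite mulrCA lm => ?; suff : 9 <= 4 * l * s by rewrite ler_pdivrMr.
    by lra.
  have si0 : 0 < s^-1 by rewrite invr_gt0.
  have := mulr_ge0 (ltW si0) (sqr_ge0 (Y s + V s)).
  have : 0 <= (4 - 9 * s^-1) * V s ^+ 2 by rewrite mulr_ge0 ?sqr_ge0 ?subr_ge0.
  have : 0 <= (4 * l - 9 * s^-1) * Y s ^+ 2.
    by rewrite mulr_ge0 ?sqr_ge0 ?subr_ge0.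
  by move: (s^-1) => i *; lra.
(* Chosen so that [- 3 Y V <= (3/2) (Y^2 + V^2) <= k E], where [m = 1 / l]. *)
pose k := 3 / 2 * (1 + m).
exists (2 * L T1), (T1 + 2 * k) => t Tt.
have T1t : T1 <= t by move: Tt; rewrite /k; lra.
have tk : 2 * k <= t by move: Tt; rewrite /k; lra.
pose E := l * Y t ^+ 2 + V t ^+ 2.
have E0 : 0 <= E by rewrite addr_ge0 ?sqr_ge0// mulr_ge0 ?sqr_ge0// ltW.
have kE : - (3 * (Y t * V t)) <= k * E.
  have -> : k * E =
      3 / 2 * (l * m * Y t ^+ 2 + V t ^+ 2 + (l * Y t ^+ 2 + m * V t ^+ 2)).
    by rewrite /k /E; ring.
  have : 0 <= l * Y t ^+ 2 + m * V t ^+ 2.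
    by apply: addr_ge0; apply: mulr_ge0; rewrite ?sqr_ge0 ?(ltW l0) ?(ltW m0).
  by rewrite lm mul1r; have := sqr_ge0 (Y t + V t); lra.
have H : t * E + 3 * (Y t * V t) <= L T1 := L_le t T1t.
by rewrite -/E; have := ler_wpM2r E0 tk; lra.
Qed.

Lemma zero_mode_velocity (t : R) : l = 0 -> t0 <= t -> t ^+ 3 * V t = t0 ^+ 3 * V t0.
Proof.
move=> l0 t0t.
have dF s : t0 <= s -> is_derive s 1 (fun r => r ^+ 3 * V r) 0.
  move=> t0s; have := dV t0s; rewrite l0 => ?.
  apply: is_derive_eq; rewrite /GRing.scale/=; field.
  exact: lt0r_neq0 (pos t0s).
apply/eqP; rewrite eq_le; apply/andP; split.
  exact: (@derive_le0_nonincr _ t0 (fun r => r ^+ 3 * V r) (fun=> 0)).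
exact: (@derive_ge0_nondecr _ t0 (fun r => r ^+ 3 * V r) (fun=> 0)).
Qed.

(** For [l = 0] both [Y + (t/2) V] and [t^3 V] are conserved; eliminating [V t] gives the
    formula. *)
Lemma zero_mode_position (t : R) : l = 0 -> t0 <= t ->
  Y t = Y t0 + t0 / 2 * (1 - (t0 / t) ^+ 2) * V t0.
Proof.
move=> l0 t0t.
have dF s : t0 <= s -> is_derive s 1 (fun r => Y r + r / 2 * V r) 0.
  move=> t0s; have := dY t0s; have := dV t0s; rewrite l0 => ? ?.
  apply: is_derive_eq; rewrite /GRing.scale/=; field.
  exact: lt0r_neq0 (pos t0s).
have /eqP : Y t + t / 2 * V t = Y t0 + t0 / 2 * V t0.
  apply/eqP; rewrite eq_le; apply/andP; split.
    exact: (@derive_le0_nonincr _ t0 (fun r => Y r + r / 2 * V r) (fun=> 0)).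
  exact: (@derive_ge0_nondecr _ t0 (fun r => Y r + r / 2 * V r) (fun=> 0)).
rewrite -subr_eq => /eqP <-.
have t_neq0 := lt0r_neq0 (pos t0t).
have -> : V t = t0 ^+ 3 / t ^+ 3 * V t0.
  by rewrite mulrAC -(zero_mode_velocity l0 t0t) mulrAC mulfV ?mul1r// expf_neq0.
by field.
Qed.

Lemma mode_cvg : 0 <= l -> exists Yinf : R,
  [/\ l * Yinf = 0, Y t @[t --> +oo] --> Yinf & V t @[t --> +oo] --> (0 : R)].
Proof.
rewrite le_eqVlt => /orP[/eqP/esym l0|l0]; last first.
  have [K [T HK]] := mode_energy_decay l0.
  have T't t : Num.max t0 T <= t -> 0 < t /\ t * (l * Y t ^+ 2 + V t ^+ 2) <= K.
    by rewrite ge_max => /andP[/pos ? /HK].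
  exists 0; split; first by rewrite mulr0.
    apply: (@cvg0_of_sqr_bound _ _ (K / l) (Num.max t0 T)) => t /T't[t_gt0 tK].
    rewrite ler_pdivlMr//; apply: le_trans tK.
    by rewrite -mulrA ler_wpM2l ?(ltW t_gt0)// [_ * l]mulrC lerDl sqr_ge0.
  apply: (@cvg0_of_sqr_bound _ _ K (Num.max t0 T)) => t /T't[t_gt0 tK].
  by apply: le_trans tK; rewrite ler_wpM2l ?(ltW t_gt0)// lerDr mulr_ge0 ?sqr_ge0// ltW.
have inv_le t : t0 <= t -> t0 / t <= 1.
  by move=> t0t; rewrite ler_pdivrMr ?pos// mul1r.
(* The limit is the conserved value of [Y + (t/2) V], as [(t/2) V] tends to 0. *)
exists (Y t0 + t0 / 2 * V t0); split; first by rewrite l0 mul0r.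
  apply/subr_cvg0.
  apply: (@cvg0_of_sqr_bound _ _ ((t0 / 2 * V t0) ^+ 2 * t0) t0) => t t0t.
  have t_neq0 := lt0r_neq0 (pos t0t).
  rewrite zero_mode_position//.
  have -> : t * (Y t0 + t0 / 2 * (1 - (t0 / t) ^+ 2) * V t0 -
      (Y t0 + t0 / 2 * V t0)) ^+ 2 = (t0 / 2 * V t0) ^+ 2 * t0 * (t0 / t) ^+ 3.
    by field.
  rewrite ler_piMr ?(mulr_ge0 (sqr_ge0 _) (ltW t0_gt0))// exprn_ile1 ?inv_le//.
  by rewrite divr_ge0 ?ltW ?pos.
apply: (@cvg0_of_sqr_bound _ _ (V t0 ^+ 2 * t0) t0) => t t0t.
have t_neq0 := lt0r_neq0 (pos t0t).
have -> : V t = t0 ^+ 3 / t ^+ 3 * V t0.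
  by rewrite mulrAC -(zero_mode_velocity l0 t0t) mulrAC mulfV ?mul1r// expf_neq0.
have -> : t * (t0 ^+ 3 / t ^+ 3 * V t0) ^+ 2 = V t0 ^+ 2 * t0 * (t0 / t) ^+ 5.
  by field.
rewrite ler_piMr ?(mulr_ge0 (sqr_ge0 _) (ltW t0_gt0))// exprn_ile1 ?inv_le//.
by rewrite divr_ge0 ?ltW ?pos.
Qed.

End undamped_mode.

(** * Complex moduli, Euclidean norms and the spectral norm *)

Lemma normc_sqr (R : realType) (z : R[i]) :
  normc z ^+ 2 = complex.Re z ^+ 2 + complex.Im z ^+ 2.
Proof. by case: z => a b /=; rewrite sqr_sqrtr// addr_ge0 ?sqr_ge0. Qed.

Lemma normc_ge0 (R : realType) (z : R[i]) : 0 <= normc z.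
Proof. by case: z => a b /=; exact: sqrtr_ge0. Qed.

Lemma normc_real (R : realType) (r : R) : normc r%:C = `|r|.
Proof. by rewrite /= expr0n/= addr0 sqrtr_sqr. Qed.

Lemma normc_sum_le (R : realType) (I : finType) (F : I -> R[i]) :
  normc (\sum_i F i) <= \sum_i normc (F i).
Proof.
elim/big_ind2 : _ => // [|z a w b za wb]; first by rewrite normc0.
exact: le_trans (le_normcD _ _) (lerD za wb).
Qed.

Lemma l2normCE (R : realType) n (z : 'cV[R[i]]_n) :
  l2normC z = Num.sqrt (\sum_i normc (z i 0) ^+ 2).
Proof. by congr Num.sqrt; apply: eq_bigr => i _; rewrite normc_sqr. Qed.

Lemma l2normC_complexify (R : realType) n (x : 'cV[R]_n) :
  l2normC (complexify x) = l2norm x.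
Proof.
congr Num.sqrt; apply: eq_bigr => i _.
by rewrite mxE /= expr0n/= addr0.
Qed.

Lemma l2normC_ge0 (R : realType) n (z : 'cV[R[i]]_n) : 0 <= l2normC z.
Proof. exact: sqrtr_ge0. Qed.

Lemma l2normCZ (R : realType) n (c : R) (z : 'cV[R[i]]_n) :
  l2normC (c%:C *: z) = `|c| * l2normC z.
Proof.
rewrite !l2normCE -sqrtr_sqr -sqrtrM ?sqr_ge0//; congr Num.sqrt.
rewrite mulr_sumr; apply: eq_bigr => i _.
by rewrite mxE normcM normc_real exprMn real_normK// num_real.
Qed.

Lemma l2normC_eq0 (R : realType) n (z : 'cV[R[i]]_n) : l2normC z = 0 -> z = 0.
Proof.
move/eqP; rewrite l2normCE sqrtr_eq0 => H; apply/colP => i; rewrite mxE.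
apply: eq0_normc; apply/eqP; rewrite -sqrf_eq0 eq_le sqr_ge0 andbT.
apply: le_trans H; rewrite (bigD1 i)//= lerDl sumr_ge0// => j _; exact: sqr_ge0.
Qed.

(** Boundedness is what makes the [sup] in [specnorm] an actual supremum; on the unit ball every
    coordinate has modulus at most 1. *)
Lemma specnorm_has_ubound (R : realType) n (P : 'M[R[i]]_n) :
  has_ubound [set l2normC (P *m z) | z in [set z | l2normC z <= 1]].
Proof.
exists (Num.sqrt (\sum_i (\sum_j normc (P i j)) ^+ 2)) => _ [w /= w1 <-].
rewrite l2normCE ler_sqrt; last by rewrite sumr_ge0// => i _; exact: sqr_ge0.
apply: ler_sum => i _.
have S0 : 0 <= \sum_j normc (P i j) by rewrite sumr_ge0// => j _; exact: normc_ge0.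
rewrite ler_pXn2r ?nnegrE ?normc_ge0//.
rewrite mxE (le_trans (normc_sum_le _))//; apply: ler_sum => j _.
rewrite normcM ler_piMr ?normc_ge0//; apply: le_trans w1.
rewrite l2normCE -[leLHS]ger0_norm ?normc_ge0// -sqrtr_sqr ler_sqrt.
  by rewrite (bigD1 j)//= lerDl sumr_ge0// => k _; exact: sqr_ge0.
by rewrite sumr_ge0// => k _; exact: sqr_ge0.
Qed.

Lemma specnorm_ge0 (R : realType) n (P : 'M[R[i]]_n) : 0 <= specnorm P.
Proof.
have l0 : l2normC (0 : 'cV[R[i]]_n) = 0.
  by rewrite -[X in l2normC X](scale0r 0) (_ : 0 = 0%:C)// l2normCZ normr0 mul0r.
apply: ub_le_sup; first exact: specnorm_has_ubound.
by exists 0; rewrite /= ?mulmx0 l0.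
Qed.

Lemma l2normC_mulmx_le (R : realType) n (P : 'M[R[i]]_n) (z : 'cV[R[i]]_n) :
  l2normC (P *m z) <= specnorm P * l2normC z.
Proof.
have [z0|z0] := eqVneq (l2normC z) 0.
  rewrite z0 mulr0 (l2normC_eq0 z0) mulmx0 -[X in l2normC X](scale0r 0).
  by rewrite (_ : 0 = 0%:C)// l2normCZ normr0 mul0r.
have nu_gt0 : 0 < l2normC z by rewrite lt_neqAle eq_sym z0 l2normC_ge0.
have zE : z = (l2normC z)%:C *: ((l2normC z)^-1%:C *: z).
  by rewrite scalerA -rmorphM/= mulfV// scale1r.
rewrite [in leLHS]zE -scalemxAr l2normCZ ger0_norm ?l2normC_ge0// mulrC.
rewrite ler_pM2r//; apply: ub_le_sup; first exact: specnorm_has_ubound.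
exists ((l2normC z)^-1%:C *: z) => //=.
by rewrite l2normCZ ger0_norm ?invr_ge0 ?l2normC_ge0// mulVf.
Qed.

(** For [B != 0], expand the squared norm of [a - (S / B) b], the residual of projecting [a] on
    [b]. *)
Lemma sum_cauchy_schwarz (R : realType) (I : finType) (a b : I -> R) :
  (\sum_i a i * b i) ^+ 2 <= (\sum_i a i ^+ 2) * (\sum_i b i ^+ 2).
Proof.
have [B0|B0] := eqVneq (\sum_i b i ^+ 2) 0.
  have b0 i : b i = 0.
    apply/eqP; rewrite -sqrf_eq0; move/eqP: B0; rewrite psumr_eq0 => [|j _].
      by move/allP => /(_ i); rewrite mem_index_enum; apply.
    exact: sqr_ge0.
  by rewrite big1 ?expr0n ?B0 ?mulr0// => i _; rewrite b0 mulr0.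
have B_gt0 : 0 < \sum_i b i ^+ 2.
  by rewrite lt_neqAle eq_sym B0 sumr_ge0// => i _; exact: sqr_ge0.
set S := \sum_i a i * b i; set B := \sum_i b i ^+ 2 in B0 B_gt0 *.
rewrite -ler_pdivrMr//.
have : 0 <= \sum_i (a i - S / B * b i) ^+ 2.
  by rewrite sumr_ge0// => i _; exact: sqr_ge0.
have -> : \sum_i (a i - S / B * b i) ^+ 2 =
    \sum_i a i ^+ 2 - 2 * (S / B) * S + (S / B) ^+ 2 * B.
  rewrite /S /B !mulr_sumr -sumrN -!big_split/=.
  by apply: eq_bigr => i _; ring.
have -> : \sum_i a i ^+ 2 - 2 * (S / B) * S + (S / B) ^+ 2 * B =
    \sum_i a i ^+ 2 - S ^+ 2 / B by field.
by rewrite subr_ge0.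
Qed.

Lemma sum_minkowski (R : realType) (I : finType) (a b : I -> R) :
  Num.sqrt (\sum_i (a i + b i) ^+ 2) <=
  Num.sqrt (\sum_i a i ^+ 2) + Num.sqrt (\sum_i b i ^+ 2).
Proof.
have S0 (c : I -> R) : 0 <= \sum_i c i ^+ 2.
  by rewrite sumr_ge0// => i _; exact: sqr_ge0.
rewrite -[leRHS]ger0_norm ?addr_ge0 ?sqrtr_ge0// -sqrtr_sqr ler_wsqrtr//.
rewrite sqrrD !sqr_sqrtr//.
have -> : \sum_i (a i + b i) ^+ 2 =
    \sum_i a i ^+ 2 + (\sum_i a i * b i) *+ 2 + \sum_i b i ^+ 2.
  by rewrite -sumrMnl -!big_split/=; apply: eq_bigr => i _; rewrite sqrrD.
rewrite lerD2r lerD2l lerMn2r/= -sqrtrM// (le_trans (ler_norm _))//.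
by rewrite -sqrtr_sqr ler_wsqrtr// sum_cauchy_schwarz.
Qed.

Lemma left_eigenvector_mode (R : realType) n (t0 l : R) (G : 'M[R]_n)
    (q : 'rV[R]_n) x v : 0 < t0 -> 0 <= l -> q *m G = l *: q ->
  ode_solution t0 G x v ->
  [/\ exists Yinf : R, [/\ l * Yinf = 0, (q *m x t) 0 0 @[t --> +oo] --> Yinf &
        (q *m v t) 0 0 @[t --> +oo] --> (0 : R)],
      forall t : R, t0 <= t -> l * (q *m x t) 0 0 ^+ 2 <=
        l * (q *m x t0) 0 0 ^+ 2 + (q *m v t0) 0 0 ^+ 2 &
      l = 0 -> forall t : R, t0 <= t -> (q *m x t) 0 0 =
        (q *m x t0) 0 0 + t0 / 2 * (1 - (t0 / t) ^+ 2) * (q *m v t0) 0 0].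
Proof.
move=> t0_gt0 l0 qG sol.
have [Y [V [eY eV dY dV]]] := ode_solution_functional q sol.
have {}dV (t : R) : t0 <= t -> is_derive t 1 V (- (3 / t) * V t - l * Y t).
  move=> t0t; have := dV t t0t.
  by rewrite qG -scalemxAl [X in _ - X]mxE -eY.
split.
- have [Yinf [lY YYinf V0]] := mode_cvg t0_gt0 dY dV l0.
  exists Yinf; split => //.
    apply: cvg_trans YYinf; apply: near_eq_cvg; near=> t; apply: eY.
    by near: t; apply: nbhs_pinfty_ge; rewrite num_real.
  apply: cvg_trans V0; apply: near_eq_cvg; near=> t; apply: eV.
  by near: t; apply: nbhs_pinfty_ge; rewrite num_real.
- move=> t t0t; rewrite -(eY t)// -(eY t0)// -(eV t0)//.
  apply: le_trans (mode_energy_le t0_gt0 dY dV t0t).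
  by rewrite lerDl sqr_ge0.
- move=> l_eq0 t t0t; rewrite -(eY t)// -(eY t0)// -(eV t0)//.
  exact: (zero_mode_position t0_gt0 dY dV l_eq0 t0t).
Unshelve. all: by end_near. Qed.

(** * Decoupling by a diagonalizing matrix *)

Section diagonalizable.
Variables (R : realType) (n : nat) (G : 'M[R]_n) (P : 'M[R[i]]_n).
Variable d : 'rV[R[i]]_n.
Hypothesis P_unit : P \in unitmx.
Hypothesis PGP : invmx P *m complexify G *m P = diag_mx d.
Hypothesis G_spec : forall z : R[i], eigenvalue (complexify G) z -> 0 <= z.

Let QG : invmx P *m complexify G = diag_mx d *m invmx P.
Proof. by rewrite -PGP mulmxK. Qed.

Let GP : complexify G *m P = P *m diag_mx d.
Proof. by rewrite -PGP !mulmxA mulmxV// mul1mx. Qed.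

Let rowQG i : row i (invmx P) *m complexify G = d 0 i *: row i (invmx P).
Proof. by rewrite -row_mul QG; apply/rowP => j; rewrite mxE mul_diag_mx !mxE. Qed.

Let d_ge0 i : 0 <= d 0 i.
Proof.
apply: G_spec; apply/eigenvalueP; exists (row i (invmx P)) => //.
apply/eqP => Q0; have : row i (invmx P *m P) = 0 by rewrite row_mul Q0 mul0mx.
by rewrite mulVmx// => /rowP/(_ i)/eqP; rewrite !mxE eqxx oner_eq0.
Qed.

Let l i := complex.Re (d 0 i).

Let dE i : d 0 i = (l i)%:C.
Proof.
by have := d_ge0 i; rewrite /l; case: (d 0 i) => a b; rewrite lecE => /andP[/eqP/= ->].
Qed.

Let l_ge0 i : 0 <= l i.
Proof. by have := d_ge0 i; rewrite dE ler0c. Qed.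

(** For a left eigenvector [w], the row [w *m P] is a left eigenvector of [diag_mx d]; any nonzero
    coordinate of it picks out the diagonal entry. *)
Let pos_eigenvalues_diag r : pos_eigenvalues G r -> exists i, r = l i.
Proof.
move=> [r0 /eigenvalueP[w wG w0]].
have uD : (w *m P) *m diag_mx d = r%:C *: (w *m P).
  by rewrite -mulmxA -GP mulmxA wG scalemxAl.
have /rV0Pn[i ui] : w *m P != 0.
  by apply: contra_neq w0 => wP; rewrite -[w](mulmxK P_unit) wP mul0mx.
exists i; move/rowP: uD => /(_ i); rewrite mul_mx_diag !mxE mulrC dE.
by move/(mulIf _) => /(_ _)/complexI; rewrite mxE in ui; move=> ->.
Qed.

Let diag_pos_eigenvalues i : 0 < l i -> pos_eigenvalues G (l i).
Proof.
move=> li0; split=> //; rewrite -dE; apply/eigenvalueP.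
exists (row i (invmx P)) => //.
apply/eqP => Q0; have : row i (invmx P *m P) = 0 by rewrite row_mul Q0 mul0mx.
by rewrite mulVmx// => /rowP/(_ i)/eqP; rewrite !mxE eqxx oner_eq0.
Qed.

Lemma velocity_const_ge t0 : t0 / 2 <= velocity_const t0 G.
Proof. by rewrite /velocity_const; case: asboolP => // _; rewrite le_max lexx. Qed.

Lemma velocity_const_eigenvalue t0 i : 0 < l i ->
  1 <= velocity_const t0 G ^+ 2 * l i.
Proof.
move=> li0; have Sli := diag_pos_eigenvalues li0.
have [m m0 m_le] : exists2 m : R, 0 < m & lbound (pos_eigenvalues G) m.
  (* A positive lower bound, which makes [inf] positive: the least positive diagonal entry, capped
     by the initial value 1. *)
  exists (\big[Num.min/1]_(j | 0 < l j) l j).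
    by apply/bigmin_gtP; split => // j.
  move=> r Sr; have [j rj] := pos_eigenvalues_diag Sr.
  by rewrite rj bigmin_le_cond// -rj; case: Sr.
have inf_gt0 : 0 < inf (pos_eigenvalues G).
  apply: lt_le_trans m0 _; apply: lb_le_inf => //.
  by exists (l i).
have inf_le : inf (pos_eigenvalues G) <= l i by apply: ge_inf => //; exists m.
rewrite /velocity_const; case: asboolP => [_|]; last by case; exists (l i).
set s := Num.sqrt _; have s0 : 0 < s by rewrite sqrtr_gt0.
apply: (@le_trans _ _ (s^-1 ^+ 2 * l i)).
  by rewrite exprVn sqr_sqrtr ?(ltW inf_gt0)// ler_pdivlMl// mulr1.
rewrite ler_wpM2r// ler_pXn2r ?nnegrE//.
- by rewrite le_max lexx orbT.
- by rewrite invr_ge0 ltW.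
- by rewrite le_max invr_ge0 (ltW s0) orbT.
Qed.

Variables (t0 : R) (x v : R -> 'cV[R]_n).
Hypothesis t0_gt0 : 0 < t0.
Hypothesis sol : ode_solution t0 G x v.

(** [P] may be complex. As the eigenvalues are real, the real and imaginary parts of each row of
    [invmx P] satisfy the same left eigenvector equation and give real modes. *)
Let reQ := map_mx (@complex.Re R) (invmx P).
Let imQ := map_mx (@complex.Im R) (invmx P).

Let rowRe i : row i reQ *m G = l i *: row i reQ.
Proof.
rewrite -map_row -Re_mulmx_complexify rowQG dE; apply/rowP => j; rewrite !mxE.
by case: (invmx P i j) => a b /=; rewrite mul0r subr0.
Qed.

Let rowIm i : row i imQ *m G = l i *: row i imQ.
Proof.
rewrite -map_row -Im_mulmx_complexify rowQG dE; apply/rowP => j; rewrite !mxE.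
by case: (invmx P i j) => a b /=; rewrite mul0r addr0.
Qed.

Let coordE i (y : 'cV[R]_n) : (invmx P *m complexify y) i 0 =
  (row i reQ *m y) 0 0 +i* (row i imQ *m y) 0 0.
Proof.
apply/eqP; rewrite eq_complex /=; apply/andP; split; apply/eqP.
  by rewrite -row_mul [RHS]mxE -Re_mulmx_complexify [RHS]mxE.
by rewrite -row_mul [RHS]mxE -Im_mulmx_complexify [RHS]mxE.
Qed.

Let modeRe i := left_eigenvector_mode t0_gt0 (l_ge0 i) (rowRe i) sol.
Let modeIm i := left_eigenvector_mode t0_gt0 (l_ge0 i) (rowIm i) sol.

(** For [l i = 0] the explicit solution has velocity factor between 0 and [t0 / 2]. For [l i > 0]
    the energy bound is divided by [l i], and [1 / l i] is at most the square of the velocity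
    constant. *)
Lemma coord_bound (t : R) i : t0 <= t ->
  normc ((invmx P *m complexify (x t)) i 0) <=
  normc ((invmx P *m complexify (x t0)) i 0) +
  velocity_const t0 G * normc ((invmx P *m complexify (v t0)) i 0).
Proof.
move=> t0t; have [_ Er Zr] := modeRe i; have [_ Ei Zi] := modeIm i.
have C_ge := velocity_const_ge t0.
have C0 : 0 <= velocity_const t0 G by apply: le_trans C_ge; rewrite divr_ge0// ltW.
have := l_ge0 i; rewrite le_eqVlt => /orP[/eqP/esym li0|li0].
  have t_gt0 := lt_le_trans t0_gt0 t0t.
  pose s := t0 / 2 * (1 - (t0 / t) ^+ 2).
  have w0 : 0 <= t0 / t by rewrite divr_ge0 ?ltW.
  have w1 : t0 / t <= 1 by rewrite ler_pdivrMr// mul1r.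
  have s0 : 0 <= s by rewrite mulr_ge0 ?divr_ge0 ?(ltW t0_gt0)// subr_ge0 expr_le1.
  have s_le : s <= velocity_const t0 G.
    apply: le_trans C_ge; rewrite ler_piMr ?divr_ge0 ?(ltW t0_gt0)//.
    by rewrite gerBl sqr_ge0.
  have -> : (invmx P *m complexify (x t)) i 0 = (invmx P *m complexify (x t0)) i 0
      + s%:C * (invmx P *m complexify (v t0)) i 0.
    rewrite !coordE Zr// Zi//; apply/eqP; rewrite eq_complex /= -/s.
    by rewrite !mul0r subr0 addr0 !eqxx.
  apply: le_trans (le_normcD _ _) _; rewrite lerD2l normcM normc_real.
  by rewrite ger0_norm// ler_wpM2r// normc_ge0.
rewrite -(@ler_pXn2r _ 2)// ?nnegrE ?addr_ge0 ?mulr_ge0 ?normc_ge0//.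
rewrite -(ler_pM2l li0).
apply: (@le_trans _ _ (l i * normc ((invmx P *m complexify (x t0)) i 0) ^+ 2 +
   normc ((invmx P *m complexify (v t0)) i 0) ^+ 2)).
  rewrite !normc_sqr !coordE /=.
  by have := Er t t0t; have := Ei t t0t; lra.
have := velocity_const_eigenvalue t0 li0.
have := normc_ge0 ((invmx P *m complexify (x t0)) i 0).
have := normc_ge0 ((invmx P *m complexify (v t0)) i 0).
move: (normc _) (normc _) (velocity_const _ _) C0 => a b C C0 b0 a0 Cl.
have : b ^+ 2 <= C ^+ 2 * l i * b ^+ 2 by rewrite ler_peMl ?sqr_ge0.
have : 0 <= l i * (2 * (C * b * a)) by rewrite !mulr_ge0// ltW.
lra.
Qed.

(** Write [x] as [P] applied to its coordinates: the coordinatewise bounds combine by Minkowski's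
    inequality, and [invmx P] bounds the initial coordinates. *)
Lemma solution_bound (t : R) : t0 <= t ->
  l2norm (x t) <=
  cond_number P * (l2norm (x t0) + velocity_const t0 G * l2norm (v t0)).
Proof.
move=> t0t.
have C0 : 0 <= velocity_const t0 G.
  by apply: le_trans (velocity_const_ge t0); rewrite divr_ge0// ltW.
have P0 : 0 <= specnorm P := specnorm_ge0 P.
pose y := invmx P *m complexify (x t0); pose w := invmx P *m complexify (v t0).
apply: (@le_trans _ _ (specnorm P * (l2normC y + velocity_const t0 G * l2normC w))).
  rewrite -l2normC_complexify -[complexify (x t)]mul1mx -(mulmxV P_unit) -mulmxA.
  apply: le_trans (l2normC_mulmx_le _ _) _; rewrite ler_wpM2l//.
  rewrite -[X in _ + X * _](ger0_norm C0) -l2normCZ !l2normCE.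
  apply: le_trans (sum_minkowski _ _); rewrite ler_wsqrtr//.
  apply: ler_sum => i _; rewrite ler_pXn2r ?nnegrE ?addr_ge0 ?normc_ge0//.
  by rewrite [X in _ + normc X]mxE normcM normc_real ger0_norm//; exact: coord_bound.
rewrite /cond_number -mulrA ler_wpM2l// mulrDr lerD//.
  by rewrite -l2normC_complexify l2normC_mulmx_le.
by rewrite mulrCA ler_wpM2l// -l2normC_complexify l2normC_mulmx_le.
Qed.

Lemma solution_cvg : exists xinf : 'cV[R]_n,
  [/\ G *m xinf = 0, x t @[t --> +oo] --> xinf &
      v t @[t --> +oo] --> (0 : 'cV[R]_n)].
Proof.
have /choice[yr yrP] := fun i => let: And3 H _ _ := modeRe i in H.
have /choice[yi yiP] := fun i => let: And3 H _ _ := modeIm i in H.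
pose yinf : 'cV[R[i]]_n := \col_i (yr i +i* yi i).
(* A real vector is the real part of [P] applied to its complex coordinates, so convergence of the
   real modes carries over to [x] and [v]. *)
have expand (y : 'cV[R]_n) j : y j 0 =
    \sum_i (complex.Re (P j i) * (row i reQ *m y) 0 0 -
            complex.Im (P j i) * (row i imQ *m y) 0 0).
  transitivity (complex.Re ((P *m (invmx P *m complexify y)) j 0)).
    by rewrite mulmxA mulmxV// mul1mx mxE.
  rewrite mxE Re_sum.
  by apply: eq_bigr => i _; rewrite coordE; case: (P j i).
have lim (f : R -> 'cV[R]_n) (a b : 'I_n -> R) :
    (forall i, (row i reQ *m f t) 0 0 @[t --> +oo] --> a i) ->
    (forall i, (row i imQ *m f t) 0 0 @[t --> +oo] --> b i) ->
    f t @[t --> +oo] -->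
      (\col_j \sum_i (complex.Re (P j i) * a i - complex.Im (P j i) * b i) : 'cV[R]_n).
  move=> fa fb; apply: cvg_cV => j; rewrite mxE.
  under eq_cvg do rewrite expand.
  apply: (@cvg_big _ _ +%R) => [|i _]; first exact: add_continuous.
  by apply: cvgB; apply: cvgMl_tmp.
exists (\col_j \sum_i (complex.Re (P j i) * yr i - complex.Im (P j i) * yi i)).
split.
(* The limit is [Re (P yinf)], and [G] maps it to [Re (P diag(d) yinf)], which is 0 because [l i]
   annihilates the limits of both modes. *)
- have -> : \col_j \sum_i (complex.Re (P j i) * yr i - complex.Im (P j i) * yi i)
      = map_mx (@complex.Re R) (P *m yinf).
    apply/colP => j; rewrite !mxE Re_sum.
    by apply: eq_bigr => i _; rewrite mxE; case: (P j i).
  have -> : G *m map_mx (@complex.Re R) (P *m yinf) =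
      map_mx (@complex.Re R) (complexify G *m (P *m yinf)).
    apply/colP => j; rewrite !mxE Re_sum; apply: eq_bigr => i _; rewrite !mxE.
    by case: (\sum_ _ _) => c e /=; rewrite mul0r subr0.
  rewrite mulmxA GP -mulmxA (_ : diag_mx d *m yinf = 0).
    by rewrite mulmx0; apply/colP => j; rewrite !mxE.
  apply/colP => i; rewrite mul_diag_mx !mxE dE; apply/eqP; rewrite eq_complex /=.
  have [-> _ _] := yrP i; have [-> _ _] := yiP i.
  by rewrite !mul0r subr0 addr0 eqxx.
- by apply: lim => i; [have [] := yrP i | have [] := yiP i].
- rewrite [X in _ --> X](_ : 0 = \col_j \sum_i
    (complex.Re (P j i) * 0 - complex.Im (P j i) * 0)).
    by apply: lim => i; [have [] := yrP i | have [] := yiP i].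
  by apply/colP => j; rewrite !mxE big1// => i _; rewrite !mulr0 subr0.
Qed.

End diagonalizable.

(** * Generic instability and boundedness, assembled *)

Theorem theorem3 (R : realType) (N : nat) (hN : (1 <= N)%N)
    (t0 : R) (ht0 : 0 < t0) (G : 'M[R]_N) :
  ((exists lambda : R[i],
      eigenvalue (complexify G) lambda /\ ~~ (0 <= lambda)) ->
    lebesgue_ae (fun z : 'cV[R]_(N + N) =>
      (exists x v : R -> 'cV[R]_N, ivp_solution t0 G z x v) /\
      (forall x v : R -> 'cV[R]_N,
         ivp_solution t0 G z x v -> grows_exponentially x)) /\
    (exists (z : 'cV[R]_(N + N)) (x v : R -> 'cV[R]_N),
       ivp_solution t0 G z x v /\ grows_exponentially x))
  /\
  ((forall lambda : R[i], eigenvalue (complexify G) lambda -> 0 <= lambda) ->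
   forall P : 'M[R[i]]_N, P \in unitmx ->
   is_diag_mx (invmx P *m complexify G *m P) ->
   forall x v : R -> 'cV[R]_N, ode_solution t0 G x v ->
     [/\ exists M : R, forall t, t0 <= t -> l2norm (x t) <= M,
         exists xinf : 'cV[R]_N,
           [/\ G *m xinf = 0,
               x t @[t --> +oo] --> xinf &
               v t @[t --> +oo] --> (0 : 'cV[R]_N)] &
         (ereal_sup [set (l2norm (x t))%:E | t in [set t | (t0 <= t)%R]] <=
          (cond_number P *
            (l2norm (x t0) + velocity_const t0 G * l2norm (v t0)))%:E)%E]).
Proof.
split; last first.
  move=> G_spec P P_unit /diag_mxP[d PGP] x v sol.
  have bound := solution_bound P_unit PGP G_spec ht0 sol.
  split; first by eexists; exact: bound.
    exact: (solution_cvg P_unit PGP G_spec ht0 sol).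
  by apply: ge_ereal_sup => _ [t /= t0t <-]; rewrite lee_fin; exact: bound.
move=> [lambda [/eigenvalueP[w wG w_neq0] lambda_nge0]].
have [a [b [a_gt0 lambdaE]]] := sqrt_positive_real_part lambda_nge0.
rewrite lambdaE in wG.
have [l l_neq0 bad] := non_growing_data_hyperplane ht0 a_gt0 wG w_neq0.
split.
  (* Solutions exist for all data, so an exceptional datum admits a non-growing solution and lies in
     the hyperplane. *)
  apply: sub_lebesgue_null (lebesgue_null_hyperplane l_neq0) => z /= nQ.
  apply: contrapT => lz; apply: nQ; split; first exact: ivp_solution_exists.
  move=> x v sol; apply: contrapT => ng; exact: lz (bad _ _ _ sol ng).
(* The normal vector [l^T] is off the hyperplane: [l *m l^T] is a sum of squares, zero only for
   [l = 0]. *)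
have [x [v sol]] := ivp_solution_exists G l^T ht0.
exists l^T, x, v; split => //; apply: contrapT => ng.
have := bad _ _ _ sol ng; rewrite mxE => /eqP.
rewrite psumr_eq0 => [/allP l0|i _]; last by rewrite mxE -expr2 sqr_ge0.
case/negP: l_neq0; apply/eqP/rowP => i.
by have := l0 i (mem_index_enum i); rewrite !mxE mulf_eq0 orbb => /eqP.
Qed.
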